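(* Let $A$ be a unital C*-algebra. Then $\widetilde P(A)$ is the set of invertible elements of $A$ whose unitary part in the polar decomposition belongs to $\overline{DU_0(A)}$, i.e., $\widetilde P(A)$ is exactly the set of elements of the form $ua$, with $u\in \overline{DU_0(A)}$ and $a\in A_+$ positive and invertible.
   Context: $A_+$ denotes the set of positive elements of the C*-algebra $A$, $P(A)$ denotes the set of all finite products of elements of $A_+$, and $\overline{P(A)}$ is its norm closure. $GL(A)$ denotes the group of invertible elements of $A$, and $\widetilde P(A)=\overline{P(A)}\cap GL(A)$. $U(A)$ denotes the unitary group of $A$ (with the norm topology), $U_0(A)$ the connected component of $1$ in $U(A)$, $DU_0(A)$ the commutator subgroup of $U_0(A)$ (the subgroup generated by the group commutators), and $\overline{DU_0(A)}$ its norm closure. The unitary part in the polar decomposition of an invertible element $x$ is the unitary $x|x|^{-1}$, where $|x|=(x^*x)^{1/2}$. *)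

(* Defs.v *)
(* MathComp-Analysis; the complex scalars are [R[i]] over an arbitrary
   [R : realType]. *)
From HB Require Import structures.
From mathcomp Require Import all_boot all_order all_algebra.
From mathcomp Require Import complex.
From mathcomp Require Import all_classical all_reals all_analysis.
Set Implicit Arguments.
Unset Strict Implicit.
Unset Printing Implicit Defensive.
Import Order.TTheory GRing.Theory Num.Theory.
Import numFieldNormedType.Exports.
Local Open Scope classical_set_scope.
Local Open Scope ring_scope.

(* A C*-algebra is unital throughout and may be zero, whereas [algType]
   forces [1 != 0]. Structures inheriting from both [pzRingType] and
   [normedZmodType] cannot be declared ([numDomainType] is their only join in
   the hierarchy), so the multiplication is introduced by raw operations and
   the [pzRingType] structure is then derived from them. *)
HB.mixin Record isCStarAlgebra (R : realType) A
    of CompleteNormedModule (complex R) A := {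
  cmul : A -> A -> A ;
  cone : A ;
  star : A -> A ;
  cmulA : associative cmul ;
  cmul1l : left_id cone cmul ;
  cmul1r : right_id cone cmul ;
  cmulDl : left_distributive cmul +%R ;
  cmulDr : right_distributive cmul +%R ;
  cmulZl : forall (k : complex R) (x y : A), cmul (k *: x) y = k *: cmul x y ;
  cmulZr : forall (k : complex R) (x y : A), cmul x (k *: y) = k *: cmul x y ;
  starK : forall x : A, star (star x) = x ;
  starD : forall x y : A, star (x + y) = star x + star y ;
  starZ : forall (k : complex R) (x : A), star (k *: x) = k^* *: star x ;
  starM : forall x y : A, star (cmul x y) = cmul (star y) (star x) ;
  norm_cmul_le : forall x y : A, `|cmul x y| <= `|x| * `|y| ;
  norm_star_cmul : forall x : A, `|cmul (star x) x| = `|x| ^+ 2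
}.

#[short(type="cstarAlgType")]
HB.structure Definition CStarAlgebra (R : realType) :=
  {A of isCStarAlgebra R A & CompleteNormedModule (complex R) A}.

HB.instance Definition _ (R : realType) (A : cstarAlgType R) :=
  GRing.Zmodule_isPzRing.Build (CStarAlgebra.sort A)
    (@cmulA R A) (@cmul1l R A) (@cmul1r R A) (@cmulDl R A) (@cmulDr R A).

Section CStarDefs.
Variables (R : realType) (A : cstarAlgType R).
Implicit Types x a u v : A.

Definition is_inverse x : set A := [set y | x * y = 1 /\ y * x = 1].

Definition GL : set A := [set x | is_inverse x !=set0].

(* [GRing.inv] needs [1 != 0]; junk value 0 outside [GL]. *)
Definition cinv x : A := xget 0 (is_inverse x).

Definition spectrum x : set (complex R) := [set k | ~ GL (x - k *: (1 : A))].

(* In [R[i]], [0 <= k] means that k is real and nonnegative. *)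
Definition positive : set A :=
  [set a | star a = a /\ spectrum a `<=` [set k | 0 <= k]].

Definition positive_products : set A :=
  [set x | exists2 s : seq A,
     (forall a, a \in s -> positive a) & x = \prod_(a <- s) a].

Definition Ptilde : set A := closure positive_products `&` GL.

Definition unitary : set A := [set u | star u * u = 1 /\ u * star u = 1].

Definition U0 : set A := connected_component unitary 1.

(* Inverses of unitaries are written with [star]. *)
Definition unitary_subgroup (H : set A) : Prop :=
  [/\ H `<=` unitary, H 1,
      (forall u v, H u -> H v -> H (u * v)) &
      (forall u, H u -> H (star u))].

Definition DU0 : set A :=
  smallest unitary_subgroup
    [set u * v * star u * star v | u in U0 & v in U0].

(* The square root of a positive element is its unique positive square root;
   junk value 0 if there is none. *)
Definition csqrt a : A := xget 0 [set h | positive h /\ h * h = a].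

Definition cabs x : A := csqrt (star x * x).

Definition unitary_part x : A := x * cinv (cabs x).

End CStarDefs.

Arguments GL {R} A.
Arguments positive {R} A.
Arguments positive_products {R} A.
Arguments Ptilde {R} A.
Arguments unitary {R} A.
Arguments U0 {R} A.
Arguments DU0 {R} A.

(* Main.v *)
(* Elementary, without the spectral radius formula or functional calculus:
   square roots and inverses come from the contraction principle, and a
   self-adjoint [a] is positive iff [|M - a| <= M] for some real [M].

   Products of positives reach the closure of DU_0: unitaries in U_0 are products
   of unitaries within O(1/n) of 1, so a commutator of two of them is a product of
   n^2 conjugates of commutators of unitaries [u ~ 1 + i h], [v ~ 1 + i k] with
   [h], [k] self-adjoint of norm O(1/n).  Such a commutator differs by O(1/n^3)
   from the product of positives (1 + k)(1 + h)(1 + k)^-1(1 + h)^-1.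

   Conversely, let [y] have its unitary part in the closure of DU_0 and let [a] be
   positive and invertible.  Along [1 + t (a - 1)], the element [a y] arises from
   [y] in n steps, multiplying by factors within O(1/n) of 1.  If [c = 1 + O(e)] is
   self-adjoint and [p > 0], then with [d = |c p| - p] the unitary part of [c p] is
   1 + [p^-1, d]/2 + O(e^2); writing [p^-1] as a multiple of the imaginary part of
   a unitary [U], the commutator [p^-1, d]/2 takes the form [x - U x U^*] with [x]
   skew-adjoint, so this is a group commutator of U_0 up to O(e^2).  Summing n
   errors O(1/n^2), the unitary part of [a y] lies in the closure of DU_0. *)
Require Import Defs.
From HB Require Import structures.
From mathcomp Require Import all_boot all_order all_algebra.
From mathcomp Require Import complex lra ring.
From mathcomp Require Import all_classical all_reals all_analysis.
From Stdlib Require Ncring Ncring_tac.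
Set Implicit Arguments.
Unset Strict Implicit.
Unset Printing Implicit Defensive.
Import Order.TTheory GRing.Theory Num.Theory.
Import numFieldNormedType.Exports.
Local Open Scope classical_set_scope.
Local Open Scope ring_scope.

(** * Norm and fixed points *)

(** Opens the algebra to noncommutative ring normalisation ([ncring] below), which settles the
    polynomial identities. *)
Instance cstar_ring_ops (R : realType) (A : cstarAlgType R) :
  @Ncring.Ring_ops A 0 1 +%R *%R (fun x y => x - y) -%R eq := {}.

Instance cstar_ring (R : realType) (A : cstarAlgType R) :
  Ncring.Ring (Ro := cstar_ring_ops A).
Proof.
by split; try exact: _; move=> * /=;
  rewrite /Algebra_syntax.equality /Ncring.eq_notation
    /Algebra_syntax.addition /Ncring.add_notation
    ?/Algebra_syntax.multiplication ?/Ncring.mul_notation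
    ?/Algebra_syntax.subtraction ?/Ncring.sub_notation
    ?/Algebra_syntax.opposite ?/Ncring.opp_notation
    ?/Algebra_syntax.zero ?/Ncring.zero_notation
    ?/Algebra_syntax.one ?/Ncring.one_notation
    ?(add0r, mul1r, mulr1, addrA, mulrA, mulrDl, mulrDr, subrr) //;
  exact: addrC.
Qed.

Ltac ncring := Ncring_tac.non_commutative_ring.

Section Norm.
Variables (R : realType) (A : cstarAlgType R).
Implicit Types (x y z : A) (r e : R).

Lemma scalAl (k : complex R) x y : (k *: x) * y = k *: (x * y).
Proof. exact: cmulZl. Qed.

Lemma scalAr (k : complex R) x y : x * (k *: y) = k *: (x * y).
Proof. exact: cmulZr. Qed.

Lemma stM x y : star (x * y) = star y * star x.
Proof. exact: starM. Qed.

Lemma star0 : star (0 : A) = 0.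
Proof. by apply: (addrI (star 0)); rewrite -starD !addr0. Qed.

Lemma starN x : star (- x) = - star x.
Proof. by apply: (addrI (star x)); rewrite -starD !subrr star0. Qed.

Lemma starB x y : star (x - y) = star x - star y.
Proof. by rewrite starD starN. Qed.

Lemma star1 : star (1 : A) = 1.
Proof. by rewrite -[LHS]mul1r -[X in X * _]starK -stM mul1r starK. Qed.

Lemma starZr r x : star (r%:C%C *: x) = r%:C%C *: star x.
Proof. by rewrite starZ; congr (_ *: _); exact: conjc_real. Qed.

Definition starE :=
  (@starD R A, starN, @starK R A, star0, star1, stM, starZr).

(* The norm of a module over [R[i]] takes its values in [R[i]]. *)
Definition nm x : R := complex.Re `|x|.

Lemma normE x : `|x| = (nm x)%:C%C.
Proof. by rewrite /nm RRe_real// ger0_real. Qed.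

Lemma nm_ge0 x : 0 <= nm x.
Proof. by rewrite -ler0c -normE. Qed.
Hint Resolve nm_ge0 : core.

Lemma nm0 : nm 0 = 0.
Proof. by rewrite /nm normr0. Qed.

Lemma nm_eq0 x : nm x = 0 -> x = 0.
Proof. by move=> h; apply/normr0_eq0; rewrite normE h. Qed.

Lemma nmN x : nm (- x) = nm x.
Proof. by rewrite /nm normrN. Qed.

Lemma nmBC x y : nm (x - y) = nm (y - x).
Proof. by rewrite -nmN opprB. Qed.

Lemma nmD x y : nm (x + y) <= nm x + nm y.
Proof. by rewrite -lecR rmorphD /= -!normE ler_normD. Qed.

Lemma nmB x y : nm (x - y) <= nm x + nm y.
Proof. by rewrite -(nmN y) nmD. Qed.

Lemma nm_dist z x y : nm (x - y) <= nm (x - z) + nm (z - y).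
Proof. by rewrite -[x - y](subrKA z) nmD. Qed.

Lemma nmM x y : nm (x * y) <= nm x * nm y.
Proof. by rewrite -lecR rmorphM /= -!normE; exact: norm_cmul_le. Qed.

Lemma nmZ r x : nm (r%:C%C *: x) = `|r| * nm x.
Proof.
apply: complexI; rewrite rmorphM /= -!normE normrZ normE; congr (_ * _).
by rewrite normc_def /= expr0n addr0 sqrtr_sqr.
Qed.

Lemma nmZi x : nm ('i%C *: x) = nm x.
Proof.
apply: complexI; rewrite -!normE normrZ normc_def /= expr0n add0r expr1n sqrtr1.
by rewrite mul1r.
Qed.

Lemma nm_star_mul x : nm (star x * x) = nm x ^+ 2.
Proof. by apply: complexI; rewrite rmorphXn /= -!normE; exact: norm_star_cmul. Qed.

Lemma nm_star x : nm (star x) = nm x.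
Proof.
suff h y : nm y <= nm (star y) by apply/le_anti; rewrite h -{2}(starK x) h.
have := nm_ge0 y; rewrite le_eqVlt => /orP[/eqP <- //|y0].
by rewrite -(ler_pM2r y0) -expr2 -nm_star_mul nmM.
Qed.

(** Only an inequality, because the zero algebra is allowed; the C*-identity gives
    [nm 1 = nm 1 ^+ 2]. *)
Lemma nm1_le1 : nm (1 : A) <= 1.
Proof.
have := nm_star_mul 1; rewrite star1 mulr1 => h.
by have := nm_ge0 (1 : A); nra.
Qed.

Lemma ball_nm x (e : complex R) y : 0 < e ->
  ball x e y = (nm (x - y) < complex.Re e).
Proof.
move=> e0; rewrite -ball_normE /ball_ /= normE.
have -> : e = (complex.Re e)%:C%C by rewrite RRe_real// gtr0_real.
by rewrite ltcR.
Qed.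

Lemma closureP (S : set A) x :
  closure S x <-> forall e, 0 < e -> exists2 y, S y & nm (x - y) < e.
Proof.
split=> [cl e e0|h B /nbhs_ballP[e /= e0 eB]].
  have e0' : 0 < e%:C%C by rewrite ltcR.
  have [y [Sy]] := cl _ (nbhsx_ballx x _ e0').
  by rewrite ball_nm //= => ?; exists y.
have e0' : 0 < complex.Re e by move: e0; rewrite ltcE /= => /andP[].
by have [y Sy xy] := h _ e0'; exists y; split=> //; apply: eB; rewrite ball_nm.
Qed.

Lemma exprn_small (q C e : R) : 0 <= q < 1 -> 0 < e -> exists n, C * q ^+ n < e.
Proof.
move=> /andP[q0 q1] e0.
have := @cvg_geometric R C q; rewrite ger0_norm // => /(_ q1).
move=> /cvgrPdist_lt /(_ _ e0) [N _ /(_ N)] /= /(_ (leqnn _)).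
by rewrite sub0r normrN => h; exists N; apply: le_lt_trans h; exact: ler_norm.
Qed.

Lemma geometric_limit (y : nat -> A) (q C : R) : 0 <= q < 1 ->
  (forall n, nm (y n.+1 - y n) <= C * q ^+ n) ->
  exists l, forall n, nm (l - y n) <= C / (1 - q) * q ^+ n.
Proof.
move=> q01 dy; have /andP[q0 q1] := q01.
have q1' : 0 < 1 - q by lra.
have C0 : 0 <= C by have := le_trans (nm_ge0 _) (dy 0%N); rewrite expr0 mulr1.
have tail n m : nm (y (n + m)%N - y n) <= C / (1 - q) * q ^+ n.
  (* The partial geometric sum, unlike its limit, reproduces itself exactly in the induction on
     [m]. *)
  suff : nm (y (n + m)%N - y n) <= C / (1 - q) * q ^+ n * (1 - q ^+ m).
    move=> h; apply: le_trans h _; rewrite ler_piMr //; last by rewrite gerBl exprn_ge0.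
    by rewrite !mulr_ge0 ?invr_ge0 ?exprn_ge0 // ltW.
  elim: m => [|m ih]; first by rewrite addn0 !subrr nm0 mulr0.
  apply: le_trans (nm_dist (y (n + m)%N) _ _) _.
  apply: le_trans (lerD _ ih) _; first by rewrite addnS; exact: dy.
  rewrite exprD exprS le_eqVlt; apply/orP; left; apply/eqP; field.
  by rewrite gt_eqF.
have small e : 0 < e -> exists N, forall m, nm (y (N + m)%N - y N) < e.
  move=> e0; have [N hN] := exprn_small (C / (1 - q)) q01 e0.
  by exists N => m; apply: le_lt_trans hN; exact: tail.
have cy : cvgn y.
  apply/cauchy_cvgP; apply/cauchy_ballP => e e0; near_simpl.
  have e0' : 0 < complex.Re e / 2.
    by move: e0; rewrite ltcE /= => /andP[_ ?]; rewrite divr_gt0.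
  have [N hN] := small _ e0'.
  exists ([set n | N <= n]%N, [set n | N <= n]%N); first by split; exists N.
  move=> [n m] [/= Nn Nm]; rewrite ball_nm //.
  apply: le_lt_trans (nm_dist (y N) _ _) _.
  have := hN (n - N)%N; have := hN (m - N)%N; rewrite !subnKC //.
  by rewrite (nmBC (y N)); lra.
exists (lim (y @ \oo)) => n; apply/ler_addgt0Pr => e e0.
have e0' : 0 < e%:C%C by rewrite ltcR.
move/cvg_ballP : cy => /(_ _ e0') [N _ hN].
have := hN (n + N)%N (leq_addl _ _); rewrite ball_nm //= => h.
apply: le_trans (nm_dist (y (n + N)%N) _ _) _.
by rewrite addrC lerD // ltW.
Unshelve. all: end_near. Qed.

(** Banach's principle. Closed properties preserved by [f], such as self-adjointness or commutation
    with given elements, are put into [U] and so reach the fixed point. *)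
Lemma contraction_fixpoint (U : set A) (f : A -> A) (q : R) (b : A) :
  0 <= q < 1 -> closure U `<=` U -> U b -> (forall x, U x -> U (f x)) ->
  (forall x y, U x -> U y -> nm (f x - f y) <= q * nm (x - y)) ->
  exists2 p, U p & p = f p.
Proof.
move=> q01 clU Ub Uf ctr; have /andP[q0 q1] := q01.
pose y n := iter n f b.
have Uy n : U (y n) by elim: n => //= n; exact: Uf.
have [n|l hl] := @geometric_limit y q (nm (f b - b)) q01.
  elim: n => [|n ih]; first by rewrite expr0 mulr1.
  have /= h := ctr _ _ (Uy n.+1) (Uy n); apply: le_trans h _.
  by rewrite exprS mulrCA ler_wpM2l.
have near e : 0 < e -> exists n, nm (l - y n) < e /\ nm (l - y n.+1) < e.
  move=> e0; have [n hn] := exprn_small (nm (f b - b) / (1 - q)) q01 e0.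
  exists n; split; apply: le_lt_trans hn => //.
  apply: le_trans (hl _) _; apply: ler_wpM2l.
    by rewrite mulr_ge0 // invr_ge0; lra.
  by rewrite exprS ler_piMl ?exprn_ge0 // ltW.
have Ul : U l.
  apply: clU; apply/closureP => e /near[n [h _]]; by exists (y n).
exists l => //; apply/eqP; rewrite -subr_eq0; apply/eqP/nm_eq0/le_anti.
rewrite nm_ge0 andbT; apply/ler_addgt0Pr => e e0; rewrite add0r.
have e2 : 0 < e / 2 by lra.
have [n [h1 h2]] := near _ e2.
apply: le_trans (nm_dist (y n.+1) _ _) _.
have := ctr _ _ (Uy n) Ul; rewrite -/(y n.+1) (nmBC (y n)) /=.
by have := nm_ge0 (l - y n); nra.
Qed.

End Norm.
#[global] Hint Extern 0 (is_true (_ <= nm _)) => exact: nm_ge0 : core.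

(** * Invertible elements *)

Section Invertible.
Variables (R : realType) (A : cstarAlgType R).
Implicit Types (x y z : A) (r e : R).

Lemma is_inverse_sym x y : is_inverse x y -> is_inverse y x.
Proof. by case. Qed.

Lemma is_inverse_uniq x y z : is_inverse x y -> is_inverse x z -> y = z.
Proof. by move=> [_ yx] [xz _]; rewrite -[y]mulr1 -xz mulrA yx mul1r. Qed.

Lemma is_inverse_comm x y z : is_inverse x y -> z * x = x * z -> z * y = y * z.
Proof.
move=> [xy yx] zx; rewrite -[LHS]mul1r -yx.
by rewrite -mulrA (mulrA x) -zx -(mulrA z) xy mulr1.
Qed.

Lemma is_inverse_star x y : is_inverse x y -> is_inverse (star x) (star y).
Proof. by move=> [xy yx]; split; rewrite -stM ?xy ?yx star1. Qed.

Lemma is_inverse_sa x y : is_inverse x y -> star x = x -> star y = y.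
Proof.
move=> xy sx; apply: (is_inverse_uniq _ xy); rewrite -{1}sx.
exact: is_inverse_star.
Qed.

Lemma is_inverseM x x' y y' : is_inverse x x' -> is_inverse y y' ->
  is_inverse (x * y) (y' * x').
Proof.
move=> [h1 h2] [h3 h4]; split.
  by rewrite -mulrA (mulrA y) h3 mul1r.
by rewrite -mulrA (mulrA x') h2 mul1r.
Qed.

Lemma is_inverseZ (k : complex R) x y : k != 0 -> is_inverse x y ->
  is_inverse (k *: x) (k^-1 *: y).
Proof.
move=> k0 [xy yx]; split; rewrite scalAl scalAr scalerA ?mulVf ?mulfV //.
  by rewrite xy scale1r.
by rewrite yx scale1r.
Qed.

Lemma cinvE x y : is_inverse x y -> cinv x = y.
Proof. by move=> xy; apply: xget_unique => // z /(is_inverse_uniq xy). Qed.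

(** The inverse is the fixed point of [y |-> 1 + x * y], sought among the elements commuting with
    [x] so that it is two-sided. The fixed point equation also yields the norm bound. *)
Lemma neumann x : nm x < 1 ->
  exists2 y, is_inverse (1 - x) y & nm y <= (1 - nm x)^-1.
Proof.
move=> x1.
pose U := [set y : A | y * x = x * y].
have [|||||y Uy yE] := @contraction_fixpoint R A U (fun y => 1 + x * y) (nm x) 0.
- by rewrite nm_ge0 x1.
- move=> y /closureP cl; apply/eqP; rewrite -subr_eq0; apply/eqP/nm_eq0/le_anti.
  rewrite nm_ge0 andbT; apply/ler_addgt0Pr => e e0; rewrite add0r.
  have e2 : 0 < e / 2 by lra.
  have [z Uz yz] := cl _ e2.
  have -> : y * x - x * y = (y - z) * x - x * (y - z).
    by rewrite mulrBl mulrBr Uz; ncring.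
  apply: le_trans (nmB _ _) _.
  have := nmM (y - z) x; have := nmM x (y - z).
  by have := nm_ge0 x; have := nm_ge0 (y - z); nra.
- by rewrite /U /= mul0r mulr0.
- by move=> y; rewrite /U /= => yx; rewrite mulrDl mulrDr mul1r mulr1 -mulrA yx.
- move=> y z _ _; have -> : 1 + x * y - (1 + x * z) = x * (y - z) by ncring.
  exact: nmM.
have i : is_inverse (1 - x) y.
  have e : (1 - x) * y = 1 by rewrite mulrBl mul1r {1}yE addrK.
  by split=> //; rewrite mulrBr mulr1 Uy -[RHS]e mulrBl mul1r.
exists y => //; rewrite -[leRHS]mul1r ler_pdivlMr; last by lra.
have := nmD 1 (x * y); rewrite -yE; have := nm1_le1 A; have := nmM x y; nra.
Qed.

(** Factor [x' = x * (1 - y * (x - x'))] and invert the second factor by [neumann]. *)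
Lemma is_inverse_perturb x y x' : is_inverse x y -> nm (x - x') * nm y < 1 ->
  exists2 y', is_inverse x' y' & nm y' <= nm y / (1 - nm (x - x') * nm y).
Proof.
move=> xy xx'.
have h : nm (y * (x - x')) <= nm (x - x') * nm y by rewrite mulrC nmM.
have [z [z1 z2] nz] := neumann (le_lt_trans h xx').
exists (z * y).
  have -> : x' = x * (1 - y * (x - x')).
    by rewrite mulrBr mulr1 mulrA xy.1 mul1r; ncring.
  exact: is_inverseM.
apply: le_trans (nmM _ _) _; rewrite [leLHS]mulrC ler_wpM2l //.
apply: le_trans nz _; rewrite lef_pV2 ?posrE; lra.
Qed.

(* Real scalars as central elements, so that identities involving them stay
   within the ring language of [ncring]. *)
Definition rs r : A := r%:C%C *: (1 : A).

Lemma rsE r x : rs r * x = r%:C%C *: x.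
Proof. by rewrite /rs scalAl mul1r. Qed.

Lemma rsC r x : x * rs r = rs r * x.
Proof. by rewrite rsE /rs scalAr mulr1. Qed.

Lemma rsD r e : rs (r + e) = rs r + rs e.
Proof. by rewrite /rs rmorphD scalerDl. Qed.

Lemma rsN r : rs (- r) = - rs r.
Proof. by rewrite /rs rmorphN scaleNr. Qed.

Lemma rsM r e : rs (r * e) = rs r * rs e.
Proof. by rewrite rsE /rs rmorphM scalerA. Qed.

Lemma rsCA r x y : x * (rs r * y) = rs r * (x * y).
Proof. by rewrite mulrA rsC mulrA. Qed.

Lemma rsMA r e x : rs r * (rs e * x) = rs (r * e) * x.
Proof. by rewrite mulrA rsM. Qed.

Lemma rs1 : rs 1 = 1.
Proof. by rewrite /rs scale1r. Qed.

Lemma rs0 : rs 0 = 0.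
Proof. by rewrite /rs scale0r. Qed.

Lemma star_rs r : star (rs r) = rs r.
Proof. by rewrite /rs !starE. Qed.

Lemma nm_rs r : nm (rs r) <= `|r|.
Proof. by rewrite /rs nmZ ler_piMr // nm1_le1. Qed.

Lemma nm_rsM r x : nm (rs r * x) = `|r| * nm x.
Proof. by rewrite rsE nmZ. Qed.

Lemma rsV r : r != 0 -> is_inverse (rs r) (rs r^-1).
Proof. by move=> r0; split; rewrite -rsM ?mulVf ?mulfV ?rs1. Qed.

Lemma GL_sub_scalar x (k : complex R) :
  nm x ^+ 2 < complex.Re k ^+ 2 + complex.Im k ^+ 2 -> GL A (x - k *: (1 : A)).
Proof.
move=> xk.
have xk' : `|x| < `|k|.
  rewrite normE normc_def ltcR -(ger0_norm (nm_ge0 x)) -sqrtr_sqr ltr_sqrt //.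
  exact: le_lt_trans (sqr_ge0 _) xk.
have k0 : k != 0 by rewrite -normr_gt0; apply: le_lt_trans xk'.
have h : nm (k^-1 *: x) < 1.
  rewrite -ltcR -normE normrZ normfV mulrC ltr_pdivrMr ?normr_gt0 //.
  by rewrite mul1r.
have [y xy _] := neumann h.
have kN0 : - k != 0 by rewrite oppr_eq0.
have := is_inverseZ kN0 xy.
rewrite scalerBr scalerA mulNr mulfV // !scaleNr scale1r opprK addrC => xy'.
by exists ((- k)^-1 *: y).
Qed.

(* Otherwise [|k + i t|^2 <= |x + i t|^2 <= |x|^2 + t^2] for every real [t]. *)
Lemma sa_resolvent x (k : complex R) : star x = x -> complex.Im k != 0 ->
  GL A (x - k *: (1 : A)).
Proof.
case: k => a b sx /= b0.
(* Then [2 * b * t = nm x ^+ 2 + 1], whatever the sign of [b], so [a ^+ 2 + (b + t) ^+ 2] exceeds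
   [nm x ^+ 2 + t ^+ 2]. *)
pose t := (nm x ^+ 2 + 1) / (2 * b).
pose y := x + (0 +i* t)%C *: (1 : A).
have -> : x - (a +i* b)%C *: (1 : A) = y - (a +i* (b + t))%C *: (1 : A).
  rewrite /y -addrA -scalerBl; congr (_ + _); rewrite -scaleNr; congr (_ *: _).
  by apply/eqP; rewrite eq_complex /= sub0r eqxx opprD addrCA subrr addr0 eqxx.
apply: GL_sub_scalar; rewrite -nm_star_mul /=.
have -> : star y * y = x * x + rs (t ^+ 2).
  rewrite /y; set J := _ *: _.
  have -> : star (x + J) = x - J.
    rewrite starD sx /J starZ star1 -scaleNr; congr (_ + _ *: _).
    by apply/eqP; rewrite eq_complex /= oppr0 !eqxx.
  have -> : (x - J) * (x + J) = x * x + (x * J - J * x) - J * J by ncring.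
  rewrite /J !scalAl !scalAr mulr1 mul1r subrr addr0 scalerA -scaleNr.
  rewrite /rs mul1r; congr (_ + _ *: _); apply/eqP; rewrite eq_complex /=.
  by rewrite !mulr0 !mul0r sub0r addr0 opprK oppr0 expr2 !eqxx.
apply: le_lt_trans (nmD _ _) _.
have := nmM x x; have := nm_rs (t ^+ 2); rewrite ger0_norm ?sqr_ge0 // => h1 h2.
have e : 2 * b * t = nm x ^+ 2 + 1 by rewrite /t; field.
by have := sqr_ge0 a; have := sqr_ge0 b; nra.
Qed.

End Invertible.

(** * Positive elements *)

Section Positive.
Variables (R : realType) (A : cstarAlgType R).
Implicit Types (a b c h x y z : A) (d r e M N : R).

(** Carries algebraic identities over to closures, with [f] the difference of the two sides. *)
Lemma closure_eq0 (S : set A) (f : A -> A) (C : R) : 0 <= C ->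
  (forall x, S x -> f x = 0) ->
  (forall x y, nm (f x - f y) <= C * nm (x - y)) ->
  forall x, closure S x -> f x = 0.
Proof.
move=> C0 S0 lip x /closureP cl; apply/nm_eq0/le_anti; rewrite nm_ge0 andbT.
apply/ler_addgt0Pr => e e0; rewrite add0r.
have e2 : 0 < e / (C + 1) by rewrite divr_gt0 //; lra.
have [y Sy xy] := cl _ e2.
have := lip x y; rewrite (S0 _ Sy) subr0 => h; apply: le_trans h _.
have : nm (x - y) * (C + 1) < e by rewrite -ltr_pdivlMr //; lra.
by have := nm_ge0 (x - y); nra.
Qed.

Lemma closure_sa (S : set A) x : (forall y, S y -> star y = y) ->
  closure S x -> star x = x.
Proof.
move=> Ssa Sx; apply/eqP; rewrite -subr_eq0; apply/eqP.
move: x Sx; apply: (@closure_eq0 S _ 2) => // [y Sy|x y].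
  by rewrite Ssa // subrr.
have -> : star x - x - (star y - y) = star (x - y) - (x - y).
  by rewrite starB; ncring.
by apply: le_trans (nmB _ _) _; rewrite nm_star; lra.
Qed.

Lemma closure_comm (S : set A) x c : (forall y, S y -> c * y = y * c) ->
  closure S x -> c * x = x * c.
Proof.
move=> Sc Sx; apply/eqP; rewrite -subr_eq0; apply/eqP.
move: x Sx; apply: (@closure_eq0 S _ (2 * nm c)) => [|y Sy|x y].
- by rewrite mulr_ge0.
- by rewrite Sc // subrr.
have -> : c * x - x * c - (c * y - y * c) = c * (x - y) - (x - y) * c by ncring.
apply: le_trans (nmB _ _) _.
by have := nmM c (x - y); have := nmM (x - y) c; lra.
Qed.

Lemma closure_nm_le (S : set A) x r : (forall y, S y -> nm y <= r) ->
  closure S x -> nm x <= r.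
Proof.
move=> Sr /closureP cl; apply/ler_addgt0Pr => e /cl[y Sy xy].
have := nm_dist y x 0; rewrite !subr0; have := Sr _ Sy; lra.
Qed.

(** The equation [(1 - y)^2 = 1 - a] reads [y = (a + y^2) / 2] and is solved as a fixed point in a
    small ball. The last clause lets roots be multiplied with whatever commutes with [a]. *)
Lemma sqrt_near1 a : star a = a -> nm a < 1 ->
  exists y, [/\ star y = y, nm y <= nm a, (1 - y) * (1 - y) = 1 - a &
    forall c, c * a = a * c -> c * y = y * c].
Proof.
(* The smaller root of [q^2 + nm a = 2 q]: the ball of radius [q] is mapped into itself, with
   contraction factor [q]. *)
move=> sa a1; pose q := 1 - Num.sqrt (1 - nm a).
have s0 : 0 < Num.sqrt (1 - nm a) by rewrite sqrtr_gt0; lra.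
have s2 : Num.sqrt (1 - nm a) ^+ 2 = 1 - nm a by rewrite sqr_sqrtr //; lra.
have na := nm_ge0 a.
have s1 : Num.sqrt (1 - nm a) <= 1 by nra.
have qq : q ^+ 2 + nm a = 2 * q by rewrite /q; nra.
pose U := [set y : A | [/\ star y = y, nm y <= q &
    forall c, c * a = a * c -> c * y = y * c]].
pose f y := rs A 2^-1 * (a + y * y).
have h2 : `|2^-1| = 2^-1 :> R by rewrite ger0_norm // invr_ge0.
have [|||||y [sy yq yc] yE] := @contraction_fixpoint R A U f q 0.
- by rewrite /q; apply/andP; split; lra.
- move=> y Uy; split.
  + by apply: closure_sa Uy => z [].
  + by apply: closure_nm_le Uy => z [].
  + by move=> c ca; apply: closure_comm Uy => z [_ _]; apply.
- split; [exact: star0|rewrite nm0 /q; lra|by move=> c _; rewrite mulr0 mul0r].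
- move=> y [sy yq yc]; split; rewrite /f.
  + by rewrite stM star_rs rsC starD stM sa sy.
  + rewrite nm_rsM h2; have := nmD a (y * y); have := nmM y y.
    by have := nm_ge0 y; nra.
  + move=> c ca; rewrite mulrA rsC -!mulrA; congr (_ * _).
    by rewrite mulrDl mulrDr ca mulrA (yc _ ca) -mulrA (yc _ ca) mulrA.
- move=> y z [_ yq _] [_ zq _]; rewrite /f -mulrBr nm_rsM h2.
  have -> : a + y * y - (a + z * z) = y * (y - z) + (y - z) * z by ncring.
  have := nmD (y * (y - z)) ((y - z) * z).
  have := nmM y (y - z); have := nmM (y - z) z.
  have := nm_ge0 (y - z); have := nm_ge0 y; have := nm_ge0 z; nra.
have q1 : q < 1 by rewrite /q; lra.
have yE2 : y + y = a + y * y.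
  rewrite yE; have -> : f y + f y = (rs A 2^-1 + rs A 2^-1) * (a + y * y).
    by rewrite /f mulrDl.
  by rewrite -rsD (_ : 2^-1 + 2^-1 = 1) ?rs1 ?mul1r -?yE //; field.
exists y; split => //.
- by apply: le_trans yq _; rewrite /q; nra.
- have -> : (1 - y) * (1 - y) = 1 + y * y - (y + y) by ncring.
  by rewrite yE2; ncring.
Qed.

(* Norm criterion for positivity; see [npos_positive] and [positive_npos]. *)
Definition npos a := star a = a /\ exists M, nm (rs A M - a) <= M.

Lemma npos_radius M N a : nm (rs A M - a) <= M -> M <= N -> nm (rs A N - a) <= N.
Proof.
move=> h MN; have -> : rs A N - a = (rs A M - a) + rs A (N - M).
  by rewrite rsD rsN; ncring.
apply: le_trans (nmD _ _) _; have := nm_rs A (N - M).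
by rewrite ger0_norm; lra.
Qed.

Lemma npos_rs r : 0 <= r -> npos (rs A r).
Proof. by move=> r0; split; [exact: star_rs|exists r; rewrite subrr nm0]. Qed.

Lemma nposD a b : npos a -> npos b -> npos (a + b).
Proof.
move=> [sa [M aM]] [sb [N bN]]; split; first by rewrite starD sa sb.
exists (M + N); have -> : rs A (M + N) - (a + b) = (rs A M - a) + (rs A N - b).
  by rewrite rsD; ncring.
by apply: le_trans (nmD _ _) _; exact: lerD.
Qed.

Lemma npos_shift_le a r e : npos (a - rs A r) -> e <= r -> npos (a - rs A e).
Proof.
move=> p er; have -> : a - rs A e = a - rs A r + rs A (r - e).
  by rewrite rsD rsN; ncring.
by apply: nposD p _; apply: npos_rs; lra.
Qed.

Lemma npos_unshift a r : npos (a - rs A r) -> 0 <= r -> npos a.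
Proof.
by move=> p r0; have := npos_shift_le p r0; rewrite rs0 subr0.
Qed.

Lemma sa_nm_npos a : star a = a -> npos (a + rs A (nm a)).
Proof.
move=> sa; split; first by rewrite starD sa star_rs.
by exists (nm a); rewrite opprD addrCA subrr addr0 nmN.
Qed.

(** Non-real [k] are excluded by [sa_resolvent]. For [k < 0] write [a - k = (a - M) - (k - M)],
    where [|k - M| > M >= nm (a - M)]. *)
Lemma npos_positive a : npos a -> positive A a.
Proof.
move=> [sa [M aM]]; split=> // k kspec.
rewrite /= lecE /=; have [/eqP k0|k0] := boolP (complex.Im k == 0); last first.
  by case: kspec; exact: sa_resolvent.
have [//|kn] := leP 0 (complex.Re k); case: kspec.
have -> : a - k *: (1 : A) = (a - rs A M) - (k - M%:C%C) *: (1 : A).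
  by rewrite scalerBl /rs; ncring.
have M0 : 0 <= M by apply: le_trans aM.
apply: GL_sub_scalar; rewrite nmBC.
have -> : complex.Re (k - M%:C%C) = complex.Re k - M by case: (k).
by have := nm_ge0 (rs A M - a); have := sqr_ge0 (complex.Im (k - M%:C%C)); nra.
Qed.

(* Completing [h] to the unitary [h + i sqrt(1 - h^2)] bounds
   [1 - h^2 = (sqrt(1 - h^2))^2] by 1. *)
Lemma nm_1_sub_sqr h : star h = h -> nm h < 1 -> nm (1 - h * h) <= 1.
Proof.
move=> sh h1.
have shh : star (h * h) = h * h by rewrite stM sh.
have h2 : nm (h * h) < 1.
  by have := nmM h h; have := nm_ge0 h; nra.
have [y [sy _ yE yc]] := sqrt_near1 shh h2.
pose g := 1 - y.
have sg : star g = g by rewrite /g starB star1 sy.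
have hg : h * g = g * h by rewrite /g mulrBr mulrBl yc ?mulr1 ?mul1r // mulrA.
pose u := h + 'i%C *: g.
have si : star ('i%C *: g) = - ('i%C *: g).
  rewrite starZ sg -scaleNr; congr (_ *: _).
  by apply/eqP; rewrite eq_complex /= oppr0 !eqxx.
have uu : star u * u = 1.
  rewrite /u starD sh si; set J := _ *: _.
  have -> : (h - J) * (h + J) = h * h + (h * J - J * h) - J * J by ncring.
  rewrite /J !scalAl !scalAr hg subrr addr0 scalerA.
  have -> : 'i%C * 'i%C = -1 :> complex R by rewrite -expr2 sqr_i.
  by rewrite scaleN1r opprK yE addrC subrK.
have u1 : nm u <= 1.
  by have := nm_star_mul u; rewrite uu; have := nm1_le1 A; have := nm_ge0 u; nra.
have g1 : nm (u - star u) = 2 * nm g.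
  have -> : u - star u = 'i%C *: (rs A 2 * g).
    rewrite /u starD sh si rsE scalerA mulrC -scalerA -rsE.
    have -> : rs A 2 = 1 + 1 by rewrite -(rs1 A) -rsD.
    ncring.
  by rewrite nmZi nm_rsM ger0_norm.
have := nmB u (star u); rewrite nm_star g1 -yE -/g.
by have := nmM g g; have := nm_ge0 g; nra.
Qed.

(** Rescaling [h] by [1 / sqrt N] reduces this to [nm_1_sub_sqr]. *)
Lemma nm_sub_sqr h N : star h = h -> nm (h * h) < N -> nm (rs A N - h * h) <= N.
Proof.
move=> sh hN; have N0 : 0 < N by apply: le_lt_trans hN.
have s0 : 0 < Num.sqrt N by rewrite sqrtr_gt0.
have s2 : Num.sqrt N ^+ 2 = N by rewrite sqr_sqrtr // ltW.
have nh : nm h ^+ 2 = nm (h * h) by rewrite -nm_star_mul sh.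
pose k := rs A (Num.sqrt N)^-1 * h.
have sk : star k = k by rewrite /k stM star_rs sh rsC.
have nk : nm k < 1.
  rewrite /k nm_rsM ger0_norm ?invr_ge0 ?ltW // mulrC ltr_pdivrMr // mul1r.
  by have := nm_ge0 h; nra.
have := nm_1_sub_sqr sk nk => k1.
have -> : rs A N - h * h = rs A N * (1 - k * k).
  have -> : k * k = rs A N^-1 * (h * h).
    by rewrite /k -mulrA rsCA rsMA -invfM -expr2 s2.
  by rewrite mulrBr mulr1 rsMA mulfV ?rs1 ?mul1r // gt_eqF.
by rewrite nm_rsM gtr0_norm // ler_piMr // ltW.
Qed.

Lemma npos_sqr h : star h = h -> npos (h * h).
Proof.
move=> sh; split; first by rewrite stM sh.
by exists (nm (h * h) + 1); apply: nm_sub_sqr => //; lra.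
Qed.

(** The hypothesis expresses [a >= d]. It puts [a] within [M] of the invertible scalar [M + d]; the
    bound on [y] follows from [(M + d) y = 1 + (M + d - a) y]. *)
Lemma spos_inverse a d : 0 < d -> npos (a - rs A d) ->
  exists2 y, is_inverse a y & nm y <= d^-1.
Proof.
move=> d0 [_ [M hM]]; have M0 : 0 <= M by apply: le_trans hM.
have Md : 0 < M + d by lra.
have MdN : M + d != 0 by rewrite gt_eqF.
have h : nm (rs A (M + d) - a) <= M.
  by move: hM; rewrite rsD opprB addrA.
have n1 : nm (rs A (M + d) - a) * nm (rs A (M + d)^-1) < 1.
  have := nm_rs A (M + d)^-1; rewrite gtr0_norm ?invr_gt0 // => k.
  have : nm (rs A (M + d) - a) * nm (rs A (M + d)^-1) <= M / (M + d).
    exact: ler_pM.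
  move/le_lt_trans; apply; rewrite ltr_pdivrMr // mul1r; lra.
have [y iy _] := is_inverse_perturb (rsV A MdN) n1.
exists y => //; rewrite -[leRHS]mul1r ler_pdivlMr //.
have : rs A (M + d) * y = 1 + (rs A (M + d) - a) * y.
  by rewrite mulrBl iy.1 addrCA subrr addr0.
move/(congr1 (@nm R A)); rewrite nm_rsM gtr0_norm //.
have := nmD 1 ((rs A (M + d) - a) * y).
have := nm1_le1 A; have := nmM (rs A (M + d) - a) y; have := nm_ge0 y; nra.
Qed.

(** Write [a = (M + d) (1 - S)]; the gap [d > 0] makes [nm S < 1], so [sqrt_near1] applies to
    [S]. *)
Lemma spos_sqrt a d : 0 < d -> npos (a - rs A d) ->
  exists h, [/\ npos h, h * h = a & forall c, c * a = a * c -> c * h = h * c].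
Proof.
move=> d0 pa; have [sa _] := npos_unshift pa (ltW d0).
have [_ [M hM]] := pa; have M0 : 0 <= M by apply: le_trans hM.
have Md : 0 < M + d by lra.
have MdN : M + d != 0 by rewrite gt_eqF.
pose S := 1 - rs A (M + d)^-1 * a.
have SE : rs A (M + d) * S = rs A (M + d) - a.
  by rewrite /S mulrBr mulr1 mulrA -rsM mulfV // rs1 mul1r.
have sS : star S = S by rewrite /S starB star1 stM sa star_rs rsC.
have nS : nm S < 1.
  have := congr1 (@nm R A) SE; rewrite nm_rsM gtr0_norm //.
  move: hM; rewrite opprB addrA -rsD => hM e.
  by rewrite -(ltr_pM2l Md) e mulr1; lra.
have [y [sy ny yE yc]] := sqrt_near1 sS nS.
pose s := Num.sqrt (M + d).
have s0 : 0 < s by rewrite sqrtr_gt0.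
exists (rs A s * (1 - y)); split.
- split; first by rewrite stM starB star1 sy star_rs rsC.
  exists s; rewrite mulrBr mulr1 opprB addrCA subrr addr0 nm_rsM gtr0_norm //.
  by rewrite ler_piMr //; lra.
- rewrite -mulrA rsCA rsMA yE -expr2 sqr_sqrtr ?ltW // /S opprB addrCA subrr.
  by rewrite addr0 rsMA mulfV // rs1 mul1r.
- move=> c ca; have cy : c * y = y * c.
    by apply: yc; rewrite /S mulrBr mulrBl mulr1 mul1r rsCA -mulrA ca.
  by rewrite rsCA -mulrA mulrBr mulrBl mulr1 mul1r cy.
Qed.

(* For small [s > 0] write [a + s = h^2]; then [a - d] is the square of
   [h sqrt(1 - (s + d) (a + s)^-1)]. *)
Lemma npos_shift a b d : npos a -> is_inverse a b -> 0 <= d -> d * nm b < 1 ->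
  npos (a - rs A d).
Proof.
move=> pa ab d0 db; have sa := pa.1.
have nb := nm_ge0 b.
(* Small enough that the inverse [y] of [a + s] still satisfies [(s + d) * nm y < 1]: this amounts
   to [2 s * nm b + d * nm b < 1]. *)
pose s := (1 - d * nm b) / (2 * (nm b + 1)).
have s0 : 0 < s by rewrite divr_gt0 //; lra.
have sE : 2 * s * (nm b + 1) = 1 - d * nm b.
  by rewrite /s; field; rewrite gt_eqF //; lra.
have pas : npos (a + rs A s - rs A s) by rewrite addrK.
have [h [[sh _] hh hc]] := spos_sqrt s0 pas.
have ns : nm (a - (a + rs A s)) <= s.
  by rewrite opprD addrA subrr add0r nmN; have := nm_rs A s; rewrite gtr0_norm.
have n1 : nm (a - (a + rs A s)) * nm b < 1 by nra.
have [y iy ny] := is_inverse_perturb ab n1.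
have sy : star y = y by apply: is_inverse_sa iy _; rewrite starD sa star_rs.
pose W := rs A (s + d) * y.
have sW : star W = W by rewrite /W stM sy star_rs rsC.
have nW : nm W < 1.
  rewrite /W nm_rsM ger0_norm; last lra.
  have n2 : 0 < 1 - nm (a - (a + rs A s)) * nm b by lra.
  move: ny; rewrite ler_pdivlMr // => ny; have := nm_ge0 y => y0.
  have : nm y * (1 - s * nm b) <= nm b.
    apply: le_trans ny; apply: ler_wpM2l => //.
    by rewrite lerB // ler_wpM2r.
  have : 0 < 1 - s * nm b by nra.
  nra.
have [g [sg _ gE gc]] := sqrt_near1 sW nW.
have hg : h * g = g * h.
  apply: gc; rewrite /W mulrA rsC -!mulrA; congr (_ * _).
  apply: is_inverse_comm iy _; rewrite -hh; ncring.
have -> : a - rs A d = (h * (1 - g)) * (h * (1 - g)).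
  have -> : (h * (1 - g)) * (h * (1 - g)) = (h * h) * ((1 - g) * (1 - g)).
    have -> : h * (1 - g) * (h * (1 - g)) = h * (h - g * h) * (1 - g) by ncring.
    by rewrite -hg; ncring.
  rewrite gE hh /W mulrBr mulr1 mulrA rsC -mulrA iy.1 mulr1 rsD; ncring.
apply: npos_sqr; rewrite stM starB star1 sg sh mulrBl mulrBr hg; ncring.
Qed.

(** Makes the radius in [npos] explicit: [a + e / 4] is a square, so [nm_sub_sqr] admits radii
    arbitrarily close to [nm a]. *)
Lemma npos_nm a : npos a -> nm (rs A (nm a) - a) <= nm a.
Proof.
move=> pa; apply/ler_addgt0Pr => e e0.
have e2 : 0 < e / 4 by lra.
have pas : npos (a + rs A (e / 4) - rs A (e / 4)) by rewrite addrK.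
have [h [[sh _] hh _]] := spos_sqrt e2 pas.
have n1 : nm (h * h) < nm a + e / 2.
  rewrite hh; apply: le_lt_trans (nmD _ _) _.
  by have := nm_rs A (e / 4); rewrite gtr0_norm //; lra.
have := nm_sub_sqr sh n1; rewrite hh => n2.
have -> : rs A (nm a) - a = (rs A (nm a + e / 2) - (a + rs A (e / 4))) - rs A (e / 4).
  have -> : rs A (nm a + e / 2) = rs A (nm a) + rs A (e / 4) + rs A (e / 4).
    by rewrite -!rsD; congr (rs A _); field.
  ncring.
apply: le_trans (nmB _ _) _.
by have := nm_rs A (e / 4); rewrite gtr0_norm //; lra.
Qed.

(** The radius [nm a] of [npos_nm] depends continuously on [a], so the norm inequality passes to the
    limit. *)
Lemma npos_closed : closure npos `<=` npos.
Proof.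
move=> a cl; split; first by apply: closure_sa cl => x [].
exists (nm a); apply/ler_addgt0Pr => e e0.
have e3 : 0 < e / 3 by lra.
have [b pb ab] := (closureP _ _).1 cl _ e3.
have := npos_nm pb.
have -> : rs A (nm a) - a = (rs A (nm b) - b) + rs A (nm a - nm b) - (a - b).
  by rewrite rsD rsN; ncring.
have := nmB (rs A (nm b) - b + rs A (nm a - nm b)) (a - b).
have := nmD (rs A (nm b) - b) (rs A (nm a - nm b)).
have := nm_rs A (nm a - nm b).
have h1 : `|nm a - nm b| <= nm (a - b).
  rewrite ler_norml; have := nm_dist b a 0; have := nm_dist a b 0.
  by rewrite !subr0 (nmBC b); lra.
have h2 := ler_norm (nm b - nm a); rewrite distrC in h2.
lra.
Qed.

(* The least [t >= 0] with [npos (a + t)] is 0, since [a + t] is invertible for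
   [t > 0], which leaves room to decrease [t]. *)
Lemma positive_npos a : positive A a -> npos a.
Proof.
move=> [sa spec].
pose T := [set t : R | 0 <= t /\ npos (a + rs A t)].
have Tna : T (nm a) by split=> //; exact: sa_nm_npos.
have lbT : has_lbound T by exists 0 => t [].
have T0 : T !=set0 by exists (nm a).
have Ti : has_inf T by [].
pose t := inf T.
have t0 : 0 <= t by apply: lb_le_inf => // r [].
have pt : npos (a + rs A t).
  apply: npos_closed; apply/closureP => e e0.
  have [r [r0 pr] rt] := inf_adherent e0 Ti.
  exists (a + rs A r) => //.
  have -> : a + rs A t - (a + rs A r) = rs A (t - r) by rewrite rsD rsN; ncring.
  apply: le_lt_trans (nm_rs _ _) _.
  have tr : t <= r by apply: ge_inf.
  by move: rt; rewrite -/t => rt; rewrite ler0_norm; lra.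
have [t00|tpos] := leP t 0.
  have tE : t = 0 by apply/le_anti; rewrite t00 t0.
  by move: pt; rewrite tE rs0 addr0.
have [b ab] : GL A (a + rs A t).
  have : ~ spectrum a (- t%:C%C).
    move=> /spec /=; rewrite lecE /= => /andP[_]; lra.
  by move=> /contrapT; rewrite scaleNr opprK.
(* The first entry keeps [t - d] nonnegative, the second gives [d * nm b < 1] for [npos_shift]. *)
pose d := Num.min t (2 * (nm b + 1))^-1.
have nb := nm_ge0 b.
have d1 : 0 < (2 * (nm b + 1))^-1 by rewrite invr_gt0; lra.
have d2 : (2 * (nm b + 1))^-1 * (2 * (nm b + 1)) = 1.
  by rewrite mulVf // gt_eqF //; lra.
have dpos : 0 < d by rewrite lt_min tpos.
have dt : d <= t by rewrite ge_min lexx.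
have d3 : d <= (2 * (nm b + 1))^-1 by rewrite ge_min lexx orbT.
have db : d * nm b < 1 by nra.
have Ttd : T (t - d).
  split; first lra.
  by have := npos_shift pt ab (ltW dpos) db; rewrite -addrA -rsN -rsD.
have : t <= t - d by apply: ge_inf.
lra.
Qed.

(* [(N + delta - p) d + d (N - r) = (2 N + delta) d - (p d + d r)], where both
   factors on the left have norm at most [N]. *)
Lemma sylvester_bound (p r d : A) (delta : R) : 0 < delta -> npos (p - rs A delta) ->
  npos r -> delta * nm d <= nm (p * d + d * r).
Proof.
move=> d0 [_ [M hM]] [_ [M' hM']].
pose N := Num.max M M'.
have h1 : nm (rs A (N + delta) - p) <= N.
  have MN : M <= N by rewrite le_max lexx.
  by have := npos_radius hM MN; rewrite rsD opprB addrA.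
have h2 : nm (rs A N - r) <= N.
  by apply: npos_radius hM' _; rewrite le_max lexx orbT.
have N0 : 0 <= N by apply: le_trans h2.
have E : rs A (N + delta + N) * d =
    (p * d + d * r) + ((rs A (N + delta) - p) * d + d * (rs A N - r)).
  rewrite rsD mulrDl -(rsC N d); ncring.
have := congr1 (@nm R A) E; rewrite nm_rsM gtr0_norm; last lra.
have := nmD (p * d + d * r) ((rs A (N + delta) - p) * d + d * (rs A N - r)).
have := nmD ((rs A (N + delta) - p) * d) (d * (rs A N - r)).
have := nmM (rs A (N + delta) - p) d; have := nmM d (rs A N - r).
have := nm_ge0 d; nra.
Qed.

End Positive.

(** * Unitary elements *)

Section Unitary.
Variables (R : realType) (A : cstarAlgType R).
Implicit Types (a b u v w x y z : A) (r s t e : R).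

Lemma unitary1 : unitary A 1.
Proof. by split; rewrite star1 mulr1. Qed.

Lemma unitaryM u v : unitary A u -> unitary A v -> unitary A (u * v).
Proof.
move=> [u1 u2] [v1 v2]; split; rewrite stM.
  by rewrite -mulrA (mulrA (star u)) u1 mul1r.
by rewrite -mulrA (mulrA v) v2 mul1r.
Qed.

Lemma unitary_star u : unitary A u -> unitary A (star u).
Proof. by move=> [u1 u2]; split; rewrite starK. Qed.

Lemma nm_unitary u : unitary A u -> nm u <= 1.
Proof.
move=> [u1 _]; have := nm_star_mul u; rewrite u1.
by have := nm1_le1 A; have := nm_ge0 u; nra.
Qed.

Lemma nm_unitaryM u x : unitary A u -> nm (u * x) = nm x.
Proof.
move=> Uu; apply/le_anti/andP; split.
  have := nmM u x; have := nm_unitary Uu; have := nm_ge0 x; nra.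
have {1}-> : x = star u * (u * x) by rewrite mulrA Uu.1 mul1r.
have := nmM (star u) (u * x); have := nm_unitary (unitary_star Uu).
have := nm_ge0 (u * x); nra.
Qed.

Lemma nm_Munitary u x : unitary A u -> nm (x * u) = nm x.
Proof.
move=> Uu; rewrite -nm_star stM nm_unitaryM ?nm_star //.
exact: unitary_star.
Qed.

Lemma unitary_inverse u : unitary A u -> is_inverse u (star u).
Proof. by case. Qed.

Lemma unitary_subgroup_unitary : unitary_subgroup (unitary A).
Proof.
by split=> //; [exact: unitary1|exact: unitaryM|exact: unitary_star].
Qed.

(** As [z] is skew-adjoint, [1 + z] is the adjoint of [1 - z] and commutes with it. *)
Lemma cayley_unitary z y : star z = - z -> is_inverse (1 - z) y ->
  unitary A ((1 + z) * y).
Proof.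
move=> sz iy; have [y1 y2] := iy.
have isy : is_inverse (1 + z) (star y).
  by have := is_inverse_star iy; rewrite starB star1 sz opprK.
have [s1 s2] := isy.
have c1 : (1 + z) * y = y * (1 + z).
  apply: (is_inverse_comm iy); ncring.
rewrite /unitary /=; have -> : star ((1 + z) * y) = star y * (1 - z).
  by rewrite stM starD star1 sz.
split.
  have -> : star y * (1 - z) * ((1 + z) * y) =
    star y * (1 + z) * ((1 - z) * y) by ncring.
  by rewrite s2 y1 mulr1.
by rewrite c1 -mulrA (mulrA (1 + z)) s1 mul1r.
Qed.

(* The Cayley transform [(1 + x/2) (1 - x/2)^-1]. *)
Lemma skew_unitary_approx x : star x = - x -> nm x <= 2^-1 ->
  exists2 u, unitary A u & nm (u - 1 - x) <= nm x ^+ 2.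
Proof.
move=> sx x2; pose z := rs A 2^-1 * x.
have h2 : `|2^-1| = 2^-1 :> R by rewrite ger0_norm // invr_ge0.
have sz : star z = - z by rewrite /z stM star_rs sx rsC mulrN.
have nz : nm z = 2^-1 * nm x by rewrite /z nm_rsM h2.
have z1 : nm z < 1 by rewrite nz; lra.
have [y iy ny] := neumann z1.
have zz : z + z = x.
  by rewrite /z -mulrDl -rsD (_ : 2^-1 + 2^-1 = 1) ?rs1 ?mul1r //; field.
exists ((1 + z) * y); first exact: cayley_unitary.
have yE : y = 1 + z * y by rewrite -iy.1; ncring.
have -> : (1 + z) * y - 1 - x = z * z * y + z * z * y.
  rewrite -zz.
  have -> : (1 + z) * y = (y - (1 + z * y)) + (1 + z * y + z * y) by ncring.
  rewrite -yE subrr add0r.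
  have e : z * y = z + z * z * y by rewrite {1}yE; ncring.
  rewrite {1}yE e; ncring.
have y2 : nm y <= 2.
  move: ny; rewrite -[leRHS]mul1r ler_pdivlMr; last lra.
  have := nm_ge0 y; nra.
have := nmD (z * z * y) (z * z * y); have := nmM (z * z) y; have := nmM z z.
have := nm_ge0 (z * z); have := nm_ge0 x; have := nm_ge0 y; rewrite nz; nra.
Qed.

(** Retracts the line onto [[0, 1]], so that the path below is unitary and Lipschitz for every real
    parameter. *)
Definition clamp t : R := Num.max 0 (Num.min 1 t).

Lemma clamp01 t : 0 <= clamp t <= 1.
Proof. by rewrite /clamp le_max lexx ge_max ler01 ge_min lexx. Qed.

Lemma clamp_id t : 0 <= t <= 1 -> clamp t = t.
Proof. by move=> /andP[t0 t1]; rewrite /clamp min_r // max_r. Qed.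

Lemma clamp_lipschitz s t : `|clamp s - clamp t| <= `|s - t|.
Proof.
wlog st : s t / t <= s.
  move=> h; have [ts|/ltW ts] := leP t s; first exact: h.
  by rewrite distrC (distrC s); exact: h.
rewrite [leRHS]ger0_norm; last lra.
rewrite /clamp.
have m01 : Num.max 0 1 = 1 :> R by rewrite max_r.
by case: (leP 1 s) => ?; case: (leP 1 t) => ?; rewrite ?m01;
  case: (leP 0 s) => ?; case: (leP 0 t) => ?; rewrite ger0_norm; lra.
Qed.

(** The inverse Cayley transform [x = (u - 1) (u + 1)^-1] is skew-adjoint, and the path is
    [(1 + t x) (1 - t x)^-1]. Here [u + 1] is invertible because it is close to the scalar 2. *)
Lemma unitary_path u : unitary A u -> nm (u - 1) <= 2^-1 ->
  exists g : R -> A, [/\ g 0 = 1, g 1 = u, forall t, unitary A (g t) &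
    forall s t, nm (g s - g t) <= 4 * `|s - t|].
Proof.
move=> Uu u1; have [uu1 uu2] := Uu.
have h2 : `|2^-1| = 2^-1 :> R by rewrite ger0_norm // invr_ge0.
have two : rs A 2 = 1 + 1 by rewrite -(rs1 A) -rsD.
have n20 : 2 != 0 :> R by [].
have nh : nm (rs A 2^-1) <= 2^-1 by rewrite -{2}h2; exact: nm_rs.
have n1 : nm (rs A 2 - (u + 1)) <= 2^-1.
  have -> : rs A 2 - (u + 1) = - (u - 1) by rewrite two; ncring.
  by rewrite nmN.
have n2 : nm (rs A 2 - (u + 1)) * nm (rs A 2^-1) <= 4^-1.
  have -> : 4^-1 = 2^-1 * 2^-1 :> R by field.
  exact: ler_pM.
have n3 : nm (rs A 2 - (u + 1)) * nm (rs A 2^-1) < 1 by lra.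
have [v iv nv] := is_inverse_perturb (rsV A n20) n3.
have v23 : nm v <= 2 / 3.
  apply: le_trans nv _; rewrite ler_pdivrMr; lra.
pose x := (u - 1) * v.
have nx : nm x <= 3^-1.
  apply: le_trans (nmM _ _) _.
  have -> : 3^-1 = 2^-1 * (2 / 3) :> R by field.
  exact: ler_pM.
have sx : star x = - x.
  have [sv1 sv2] := is_inverse_star iv.
  have e : (star u + 1) * ((1 - u) * v) = star u - 1.
    have -> : (star u + 1) * ((1 - u) * v) =
      ((star u - 1) * (u + 1) + (1 - star u * u) + (1 - star u * u)) * v.
      ncring.
    by rewrite uu1 subrr !addr0 -mulrA iv.1 mulr1.
  have -> : - x = (1 - u) * v by rewrite /x; ncring.
  rewrite /x stM starB star1 -e mulrA.
  by move: sv2; rewrite starD star1 => ->; rewrite mul1r.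
pose X t := rs A (clamp t) * x.
have nX t : nm (X t) <= 3^-1.
  rewrite /X nm_rsM; have /andP[c0 c1] := clamp01 t.
  by rewrite ger0_norm //; have := nm_ge0 x; nra.
have /choice[y iy] t : exists y, is_inverse (1 - X t) y /\ nm y <= 3 / 2.
  have nX1 : nm (X t) < 1 by have := nX t; lra.
  have [y iy ny] := neumann nX1; exists y; split => //.
  apply: le_trans ny _; rewrite -[leLHS]mul1r ler_pdivrMr; have := nX t; lra.
exists (fun t => (1 + X t) * y t); split.
- have X0 : X 0 = 0 by rewrite /X clamp_id ?lexx ?ler01 // rs0 mul0r.
  by have := (iy 0).1.1; rewrite X0 subr0 addr0.
- have X1 : X 1 = x by rewrite /X clamp_id ?lexx ?ler01 // rs1 mul1r.
  have [[y1 y2] _] := iy 1; rewrite X1 in y1 y2 *.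
  have e1 : (1 - x) * (u + 1) = 1 + 1.
    have -> : (1 - x) * (u + 1) = (u + 1) - (u - 1) * (v * (u + 1)).
      by rewrite /x; ncring.
    rewrite iv.2; ncring.
  have e2 : y 1 + y 1 = u + 1.
    have -> : y 1 + y 1 = y 1 * (1 + 1) by ncring.
    by rewrite -e1 mulrA y2 mul1r.
  have -> : (1 + x) * y 1 = (y 1 + y 1) - (1 - x) * y 1 by ncring.
  by rewrite e2 y1 addrK.
- move=> t; apply: cayley_unitary (iy t).1.
  by rewrite /X stM star_rs sx rsC mulrN.
- move=> s t; have [[ys1 ys2] nys] := iy s; have [[yt1 yt2] nyt] := iy t.
  have e r : (1 + X r) * y r = y r + y r - 1.
    have -> : (1 + X r) * y r = y r + y r - (1 - X r) * y r by ncring.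
    by rewrite (iy r).1.1.
  (* The resolvent identity for [(1 - X s)^-1 - (1 - X t)^-1]. *)
  have d : y s - y t = rs A (clamp s - clamp t) * (y s * x * y t).
    have -> : y s - y t = y s * (1 - X t) * y t - y s * ((1 - X s) * y t) +
      (y s * (1 - (1 - X t) * y t)) - (1 - y s * (1 - X s)) * y t by ncring.
    rewrite ys2 yt1 !subrr mulr0 mul0r subr0 addr0.
    have -> : y s * (1 - X t) * y t - y s * ((1 - X s) * y t) =
      y s * (X s - X t) * y t by ncring.
    by rewrite /X -mulrBl -rsN -rsD rsCA !mulrA.
  rewrite !e (_ : _ - _ = (y s - y t) + (y s - y t)); last ncring.
  apply: le_trans (nmD _ _) _; rewrite d nm_rsM.
  have m1 : nm (y s * x * y t) <= 2.
    apply: le_trans (nmM _ _) _.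
    have m2 := le_trans (nmM (y s) x) (ler_pM (nm_ge0 _) (nm_ge0 _) nys nx).
    have := ler_pM (nm_ge0 _) (nm_ge0 _) m2 nyt; lra.
  have := clamp_lipschitz s t; have := nm_ge0 (y s * x * y t).
  set c := `|clamp s - clamp t|; have : 0 <= c by exact: normr_ge0.
  nra.
Qed.

Lemma near1_U0 u : unitary A u -> nm (u - 1) <= 2^-1 -> U0 A u.
Proof.
move=> Uu u1; have [g [g0 g1 Ug lg]] := unitary_path Uu u1.
have cg : continuous g.
  move=> t; apply/cvg_ballP => e e0; have e0' : 0 < complex.Re e.
    by move: e0; rewrite ltcE /= => /andP[].
  have e4 : 0 < complex.Re e / 4 by rewrite divr_gt0.
  apply/nbhs_ballP; exists (complex.Re e / 4) => //= s.
  move=> ts; have {}ts : `|t - s| < complex.Re e / 4 by [].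
  rewrite /= ball_nm //; apply: le_lt_trans (lg _ _) _; lra.
apply: (@connected_component_max _ (unitary A) (g @` `[0, 1]%classic)).
- by exists 0; rewrite //= in_itv /= lexx ler01.
- by move=> _ [t _ <-].
- apply: connected_continuous_connected; first exact: segment_connected.
  exact: continuous_subspaceT.
- by exists 1; rewrite //= in_itv /= lexx ler01.
Qed.

Lemma U0_unitary u : U0 A u -> unitary A u.
Proof. exact: connected_component_sub. Qed.

(** A subgroup containing a neighbourhood of 1 is open, and closed since it contains every unitary
    close to one of its elements; connectedness of [U0] concludes. *)
Lemma U0_sub_subgroup (H : set A) (e : R) : unitary_subgroup H -> 0 < e ->
  (forall u, unitary A u -> nm (u - 1) < e -> H u) -> U0 A `<=` H.
Proof.
move=> [HU H1 HM HS] e0 near.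
have step u v : H u -> unitary A v -> nm (u - v) < e -> H v.
  move=> Hu Uv uv; have Uu := HU _ Hu.
  rewrite -[v]mul1r -Uu.2 -mulrA; apply: HM => //; apply: near.
    by apply: unitaryM => //; exact: unitary_star.
  rewrite -Uu.1 -mulrBr nm_unitaryM 1?nmBC //; exact: unitary_star.
have e0' : 0 < e%:C%C by rewrite ltcR.
suff <- : U0 A `&` H = U0 A by apply: subIsetr.
apply: (@component_connected _ (unitary A) 1).
- by exists 1; split=> //; apply: connected_component_refl; exact: unitary1.
- exists (\bigcup_(u in H) ball u e%:C%C).
    apply: bigcup_open => u _; exact: ball_open.
  rewrite eqEsubset; split=> u [Uu].
    move=> Hu; split=> //; exists u => //; exact: ballxx.
  move=> [v Hv]; rewrite ball_nm //= => vu; split=> //.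
  by apply: step vu => //; exact: U0_unitary.
- exists (closure H); first exact: closed_closure.
  rewrite eqEsubset; split=> u [Uu].
    by move=> Hu; split=> //; exact: subset_closure.
  move=> /closureP /(_ _ e0)[v Hv uv]; split=> //.
  by apply: (step v) => //; [exact: U0_unitary|rewrite nmBC].
Qed.

Lemma DU0_subgroup : unitary_subgroup (DU0 A).
Proof.
have comU : [set u * v * star u * star v | u in U0 A & v in U0 A] `<=` unitary A.
  move=> _ [u /U0_unitary Uu [v /U0_unitary Uv <-]].
  by apply: unitaryM; [apply: unitaryM; [exact: unitaryM|]|];
    exact: unitary_star.
split.
- apply: smallest_sub comU; exact: unitary_subgroup_unitary.
- by move=> H [[]].
- move=> u v Du Dv H HH; have [[_ _ HM _] _] := HH.
  by apply: HM; [exact: Du|exact: Dv].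
- move=> u Du H HH; have [[_ _ _ HS] _] := HH; by apply: HS; exact: Du.
Qed.

Lemma DU0_commutator u v : U0 A u -> U0 A v -> DU0 A (u * v * star u * star v).
Proof. by move=> Uu Uv; apply: sub_gen_smallest; exists u => //; exists v. Qed.

Lemma closureM (S T V : set A) : (forall x y, S x -> T y -> V (x * y)) ->
  forall x y, closure S x -> closure T y -> closure V (x * y).
Proof.
move=> STV x y /closureP cx /closureP cy; apply/closureP => e e0.
have nx := nm_ge0 x; have ny := nm_ge0 y.
pose d := Num.min 1 (e / (nm x + nm y + 2)).
have k0 : 0 < nm x + nm y + 2 by lra.
have d0 : 0 < d by rewrite lt_min ltr01 divr_gt0.
have d1 : d <= 1 by rewrite ge_min lexx.
have dk : d * (nm x + nm y + 2) <= e.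
  by rewrite -ler_pdivlMr // ge_min lexx orbT.
have [x' Sx xx'] := cx _ d0; have [y' Ty yy'] := cy _ d0.
exists (x' * y'); first exact: STV.
have -> : x * y - x' * y' = x * (y - y') + (x - x') * y' by ncring.
apply: le_lt_trans (nmD _ _) _.
have := nmM x (y - y'); have := nmM (x - x') y'.
have := nm_dist y y' 0; rewrite !subr0 (nmBC y') => h.
have := nm_ge0 (x - x'); have := nm_ge0 (y - y'); have := nm_ge0 y'; nra.
Qed.

Lemma closure_star (S : set A) : (forall x, S x -> S (star x)) ->
  forall x, closure S x -> closure S (star x).
Proof.
move=> Ss x /closureP cx; apply/closureP => e /cx[y Sy xy].
by exists (star y); [exact: Ss|rewrite -starB nm_star].
Qed.

Lemma small_eq0 x (C : R) : 0 <= C -> (forall e, 0 < e -> nm x <= C * e) -> x = 0.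
Proof.
move=> C0 h; apply/nm_eq0/le_anti; rewrite nm_ge0 andbT.
apply/ler_addgt0Pr => e e0; rewrite add0r.
have C1 : 0 < C + 1 by lra.
have e2 : 0 < e / (C + 1) by rewrite divr_gt0.
apply: le_trans (h _ e2) _; rewrite mulrCA ler_piMr ?ltW // ltr_pdivrMr //; lra.
Qed.

Lemma closure_unitary : closure (unitary A) `<=` unitary A.
Proof.
suff h u : closure (unitary A) u -> star u * u = 1.
  move=> u cu; split; first exact: h.
  rewrite -{1}[u]starK; apply: h; apply: closure_star cu.
  exact: unitary_star.
move=> /closureP cu; apply/eqP; rewrite -subr_eq0; apply/eqP.
apply: (@small_eq0 _ (nm u + 1)) => [|e /cu[v Uv uv]].
  by have := nm_ge0 u; lra.
have -> : star u * u - 1 = star u * (u - v) + star (u - v) * v.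
  by rewrite starB -{1}Uv.1; ncring.
apply: le_trans (nmD _ _) _; rewrite (nm_Munitary _ Uv).
have := nmM (star u) (u - v); rewrite !nm_star.
by have := nm_ge0 u; have := nm_ge0 (u - v); nra.
Qed.

End Unitary.

(** * Commutators and products of positive elements *)

Section Products.
Variables (R : realType) (A : cstarAlgType R).
Implicit Types (a b g u v w x y z : A) (r s t e : R).

Local Notation PP := (positive_products A).

Lemma npos_near1 a : star a = a -> nm (a - 1) <= 1 -> npos a.
Proof. by move=> sa a1; split=> //; exists 1; rewrite rs1 nmBC. Qed.

Lemma npos_conj u a : unitary A u -> npos a -> npos (u * a * star u).
Proof.
move=> Uu [sa [M aM]]; split; first by rewrite !stM starK sa mulrA.
exists M; have -> : rs A M - u * a * star u = u * (rs A M - a) * star u.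
  by rewrite mulrBr mulrBl rsC -(mulrA (rs A M)) Uu.2 mulr1.
by rewrite nm_Munitary ?nm_unitaryM //; exact: unitary_star.
Qed.

Lemma PP1 : PP 1.
Proof. by exists [::] => //; rewrite big_nil. Qed.

Lemma PPM x y : PP x -> PP y -> PP (x * y).
Proof.
move=> [s sp ->] [t tp ->]; exists (s ++ t); last by rewrite big_cat.
by move=> a; rewrite mem_cat => /orP[/sp|/tp].
Qed.

Lemma positive_PP a : positive A a -> PP a.
Proof.
move=> pa; exists [:: a]; last by rewrite big_seq1.
by move=> b; rewrite inE => /eqP ->.
Qed.

Lemma npos_PP a : npos a -> PP a.
Proof. by move=> /npos_positive/positive_PP. Qed.

Lemma PP_ind (Q : A -> Prop) : Q 1 ->
  (forall a x, npos a -> PP x -> Q x -> Q (a * x)) -> forall x, PP x -> Q x.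
Proof.
move=> Q1 QM _ [s sp ->]; elim: s sp => [|a s ih] sp; first by rewrite big_nil.
have ps b : b \in s -> positive A b by move=> bs; apply: sp; rewrite inE bs orbT.
rewrite big_cons; apply: QM; last exact: ih.
  by apply: positive_npos; apply: sp; rewrite inE eqxx.
by exists s.
Qed.

Lemma PP_star x : PP x -> PP (star x).
Proof.
move: x; apply: PP_ind => [|a x pa _ ih]; first by rewrite star1; exact: PP1.
by rewrite stM pa.1; apply: PPM => //; exact: npos_PP.
Qed.

Lemma PP_conj u x : unitary A u -> PP x -> PP (u * x * star u).
Proof.
move=> Uu; move: x; apply: PP_ind => [|a x pa _ ih].
  by rewrite mulr1 Uu.2; exact: PP1.
have -> : u * (a * x) * star u = (u * a * star u) * (u * x * star u).
  have h y : star u * (u * y) = y by rewrite mulrA Uu.1 mul1r.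
  by rewrite -!mulrA h.
by apply: PPM => //; apply: npos_PP; exact: npos_conj.
Qed.

Definition commutator u v := u * v * star u * star v.

Lemma star_commutator u v : star (commutator u v) = commutator v u.
Proof. by rewrite /commutator !stM !starK !mulrA. Qed.

Lemma commutator_unitary u v : unitary A u -> unitary A v ->
  unitary A (commutator u v).
Proof.
move=> Uu Uv; rewrite /commutator.
by apply: unitaryM; [apply: unitaryM; [exact: unitaryM|]|]; exact: unitary_star.
Qed.

(** Reduces the commutator of a product with [w] to commutators of its factors, up to unitary
    conjugation. *)
Lemma commutatorM u v w : unitary A u -> unitary A w ->
  commutator (u * v) w = u * commutator v w * star u * commutator u w.
Proof.
move=> [u1 _] [w1 _].
have hu x : star u * (u * x) = x by rewrite mulrA u1 mul1r.
have hw x : star w * (w * x) = x by rewrite mulrA w1 mul1r.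
by rewrite /commutator stM -!mulrA hu hw.
Qed.

Lemma commutator_starl u v : unitary A u ->
  commutator (star u) v = star u * star (commutator u v) * u.
Proof.
move=> [u1 _]; rewrite star_commutator /commutator starK -!mulrA u1 mulr1.
by rewrite !mulrA.
Qed.

Lemma commutator1 v : unitary A v -> commutator 1 v = 1.
Proof. by move=> [_ v2]; rewrite /commutator star1 mul1r mulr1. Qed.

(* With [u ~ 1 + i h] and [v ~ 1 + i k] the commutator of [u] and [v] agrees to
   second order with that of the positive elements [1 + k] and [1 + h]. *)
Lemma commutator_near_product u v e : unitary A u -> unitary A v -> e <= 4^-1 ->
  nm (u - 1) <= e -> nm (v - 1) <= e ->
  exists2 g, PP g & nm (commutator u v - g) <= 20 * e ^+ 3.
Proof.
move=> Uu Uv e4 ue ve.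
have e0 : 0 <= e by apply: le_trans ue.
have h2 : `|2^-1| = 2^-1 :> R by rewrite ger0_norm // invr_ge0.
have dec z : nm (z - 1) <= e -> unitary A z ->
    exists X h p, [/\ nm X <= e, h = - 'i%C *: X, npos (1 + h),
      npos p & [/\ is_inverse (1 + h) p, nm (p - 1) <= 2 * e, nm p <= 2 &
      nm ((z - 1) - X) <= 2^-1 * e ^+ 2]].
  (* [X] is the skew-adjoint part of [z - 1]. The self-adjoint part equals
     [- star (z - 1) * (z - 1) / 2] because [z] is unitary, hence is of second order. *)
  move=> ze Uz; pose X := rs A 2^-1 * (z - star z); pose h := - 'i%C *: X.
  have hX : nm h = nm X by rewrite /h scaleNr nmN nmZi.
  have nX : nm X <= e.
    have -> : X = rs A 2^-1 * ((z - 1) - star (z - 1)).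
      by rewrite /X starB star1; congr (_ * _); ncring.
    rewrite nm_rsM h2; have := nmB (z - 1) (star (z - 1)); rewrite nm_star; lra.
  have sh : star h = h.
    rewrite /h starZ /X stM star_rs starB starK rsC -opprB mulrN scalerN -scaleNr.
    congr (_ *: _); apply/eqP; rewrite eq_complex /=.
    by rewrite ?(opprK, oppr0, eqxx).
  have nh : nm (- h) < 1 by rewrite nmN hX; lra.
  have [p ip np] := neumann nh; rewrite opprK in ip.
  have np2 : nm p <= 4 / 3.
    apply: le_trans np _; rewrite -[leLHS]mul1r ler_pdivrMr nmN hX; lra.
  have np1 : nm (p - 1) <= 2 * e.
    have -> : p - 1 = - (h * p).
      have -> : p - 1 = (1 + h) * p - 1 - h * p by ncring.
      by rewrite ip.1 subrr add0r.
    rewrite nmN; have := nmM h p; rewrite hX.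
    by have := nm_ge0 X; have := nm_ge0 p; nra.
  have sp : star p = p.
    have := is_inverse_sa ip; apply; by rewrite starD star1 sh.
  exists X, h, p; split=> //.
  - apply: npos_near1; first by rewrite starD star1 sh.
    by rewrite addrAC subrr add0r hX; lra.
  - by apply: npos_near1 => //; lra.
  split=> //; first lra.
  have -> : z - 1 - X = - (rs A 2^-1 * (star (z - 1) * (z - 1))).
    have -> : star (z - 1) * (z - 1) = (1 + 1) - (z + star z).
      rewrite starB star1 mulrBl mulrBr Uz.1; ncring.
    have half : rs A 2^-1 * (1 + 1) = 1.
      by rewrite mulrDr mulr1 -rsD -[RHS]rs1; congr (rs A _); field.
    have zE : X + rs A 2^-1 * (z + star z) = z.
      have -> : X + rs A 2^-1 * (z + star z) = rs A 2^-1 * (1 + 1) * z.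
        by rewrite /X; ncring.
      by rewrite half mul1r.
    by rewrite mulrBr half -{1}zE; ncring.
  rewrite nmN nm_rsM h2 nm_star_mul ler_wpM2l ?invr_ge0 //.
  by rewrite lerXn2r // nnegrE.
have [X [h [p [nX hE ph pp [ip np1 np xX]]]]] := dec _ ue Uu.
have [Y [k [q [nY kE pk pq [iq nq1 nq yY]]]]] := dec _ ve Uv.
exists ((1 + k) * (1 + h) * q * p).
  by apply: PPM; [apply: PPM; [apply: PPM|]|]; exact: npos_PP.
(* The factor [(- i)^2 = -1] reverses the commutator, which is why the approximating product starts
   with [1 + k]. *)
have kh : k * h - h * k = X * Y - Y * X.
  rewrite hE kE !scalAl !scalAr !scalerA.
  have -> : - 'i%C * - 'i%C = -1 :> complex R.
    by rewrite mulrNN -expr2 sqr_i.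
  rewrite !scaleN1r; ncring.
have -> : (1 + k) * (1 + h) * q * p = 1 + (X * Y - Y * X) * (q * p).
  have -> : (1 + k) * (1 + h) * q * p =
    (1 + h) * ((1 + k) * q) * p + (k * h - h * k) * (q * p) by ncring.
  by rewrite iq.1 mulr1 ip.1 kh.
set x := u - 1; set y := v - 1.
have -> : commutator u v = 1 + (x * y - y * x) * (star u * star v).
  have -> : commutator u v = v * (u * star u) * star v +
      (x * y - y * x) * (star u * star v).
    by rewrite /commutator /x /y; ncring.
  by rewrite Uu.2 mulr1 Uv.2.
have -> : 1 + (x * y - y * x) * (star u * star v) -
    (1 + (X * Y - Y * X) * (q * p)) =
  ((x * y - y * x) - (X * Y - Y * X)) * (star u * star v) +
  (X * Y - Y * X) * (star u * star v - q * p) by ncring.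
have n1 : nm (x * y - y * x - (X * Y - Y * X)) <= 2 * e ^+ 3.
  have -> : x * y - y * x - (X * Y - Y * X) =
    (x * (y - Y) - (y - Y) * x) + ((x - X) * Y - Y * (x - X)) by ncring.
  have m1 := le_trans (nmM x (y - Y)) (ler_pM (nm_ge0 _) (nm_ge0 _) ue yY).
  have m2 := le_trans (nmM (y - Y) x) (ler_pM (nm_ge0 _) (nm_ge0 _) yY ue).
  have m3 := le_trans (nmM (x - X) Y) (ler_pM (nm_ge0 _) (nm_ge0 _) xX nY).
  have m4 := le_trans (nmM Y (x - X)) (ler_pM (nm_ge0 _) (nm_ge0 _) nY xX).
  apply: le_trans (nmD _ _) _.
  have := nmB (x * (y - Y)) ((y - Y) * x); have := nmB ((x - X) * Y) (Y * (x - X)).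
  rewrite (_ : e ^+ 3 = e * e ^+ 2) ?exprS //; lra.
have n2 : nm (X * Y - Y * X) <= 2 * e ^+ 2.
  have m1 := le_trans (nmM X Y) (ler_pM (nm_ge0 _) (nm_ge0 _) nX nY).
  have m2 := le_trans (nmM Y X) (ler_pM (nm_ge0 _) (nm_ge0 _) nY nX).
  have := nmB (X * Y) (Y * X); rewrite expr2; lra.
have n3 : nm (star u * star v - q * p) <= 8 * e.
  have -> : star u * star v - q * p =
    star u * star (v - 1) + star (u - 1) - ((q - 1) * p + (p - 1)).
    by rewrite !starB star1; ncring.
  have := nmB (star u * star (v - 1) + star (u - 1)) ((q - 1) * p + (p - 1)).
  have := nmD (star u * star (v - 1)) (star (u - 1)).
  have := nmD ((q - 1) * p) (p - 1).
  rewrite (nm_unitaryM _ (unitary_star Uu)) !nm_star.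
  have := le_trans (nmM (q - 1) p) (ler_pM (nm_ge0 _) (nm_ge0 _) nq1 np); lra.
apply: le_trans (nmD _ _) _.
rewrite nm_Munitary; last by apply: unitaryM; exact: unitary_star.
have := le_trans (nmM _ _) (ler_pM (nm_ge0 _) (nm_ge0 _) n2 n3).
rewrite (_ : 2 * e ^+ 2 * (8 * e) = 16 * e ^+ 3); last ring.
have : 0 <= e ^+ 3 by rewrite exprn_ge0.
lra.
Qed.

(** The bound [nm g <= 1] makes errors merely add up under products, however many factors there
    are. *)
Definition approximable e w := exists g, [/\ PP g, nm g <= 1 & nm (w - g) <= e].

Lemma approximableM e s w x : unitary A w ->
  approximable e w -> approximable s x -> approximable (e + s) (w * x).
Proof.
move=> Uw [g [Pg g1 wg]] [k [Pk k1 xk]]; exists (g * k); split.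
- exact: PPM.
- by have := nmM g k; have := nm_ge0 g; have := nm_ge0 k; nra.
have -> : w * x - g * k = (w - g) * k + w * (x - k) by ncring.
apply: le_trans (nmD _ _) _; rewrite (nm_unitaryM _ Uw).
by have := nmM (w - g) k; have := nm_ge0 (w - g); have := nm_ge0 k; nra.
Qed.

Lemma approximable_conj e u w : unitary A u -> approximable e w ->
  approximable e (u * w * star u).
Proof.
move=> Uu [g [Pg g1 wg]]; have Us := unitary_star Uu.
exists (u * g * star u); split; first exact: PP_conj.
  by rewrite nm_Munitary ?nm_unitaryM.
have -> : u * w * star u - u * g * star u = u * (w - g) * star u by ncring.
by rewrite nm_Munitary ?nm_unitaryM.
Qed.

Lemma approximable_star e w : approximable e w -> approximable e (star w).
Proof.
move=> [g [Pg g1 wg]]; exists (star g); split; first exact: PP_star.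
  by rewrite nm_star.
by rewrite -starB nm_star.
Qed.

(** Since [nm g <= 1 + e], dividing [g] by [1 + e] makes it a contraction and moves it by at most
    [e]. *)
Lemma approximable_normalize e w g : unitary A w -> PP g -> nm (w - g) <= e ->
  approximable (2 * e) w.
Proof.
move=> Uw Pg wg; have e0 : 0 <= e by apply: le_trans wg.
have e1 : 1 + e != 0 by rewrite gt_eqF //; lra.
have i0 : 0 < (1 + e)^-1 by rewrite invr_gt0; lra.
have ng : nm g <= 1 + e.
  have := nm_dist w g 0; rewrite !subr0 nmBC; have := nm_unitary Uw; lra.
have ii : (1 + e)^-1 * (1 + e) = 1 by rewrite mulVf.
exists (rs A (1 + e)^-1 * g); split.
- by apply: PPM => //; apply: npos_PP; apply: npos_rs; exact: ltW.
- by rewrite nm_rsM gtr0_norm //; have := nm_ge0 g; nra.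
have := nm_dist g w (rs A (1 + e)^-1 * g).
have -> : g - rs A (1 + e)^-1 * g = rs A ((1 + e)^-1 * e) * g.
  have -> : (1 + e)^-1 * e = 1 - (1 + e)^-1.
    have -> : (1 + e)^-1 * e = (1 + e)^-1 * (1 + e) - (1 + e)^-1 by ring.
    by rewrite ii.
  by rewrite rsD rs1 rsN mulrDl mul1r mulNr.
rewrite nm_rsM ger0_norm; last by rewrite mulr_ge0 // ltW.
have h : (1 + e)^-1 * e * nm g <= e.
  have -> : (1 + e)^-1 * e * nm g = e * ((1 + e)^-1 * nm g) by ring.
  by rewrite ler_piMr //; nra.
lra.
Qed.

(** Cut the path into [n] steps: consecutive points differ by a unitary factor within [4 / n] of 1,
    and [commutatorM] adds one conjugated small commutator per step. *)
Lemma approximable_path (g : R -> A) (n : nat) w e : (0 < n)%N ->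
  g 0 = 1 -> (forall t, unitary A (g t)) ->
  (forall s t, nm (g s - g t) <= 4 * `|s - t|) -> unitary A w ->
  (forall u, unitary A u -> nm (u - 1) <= 4 / n%:R ->
    approximable e (commutator u w)) ->
  approximable (n%:R * e) (commutator (g 1) w).
Proof.
move=> n0 g0 Ug lg Uw near.
have n0' : 0 < n%:R :> R by rewrite ltr0n.
have n0'' : n%:R != 0 :> R by rewrite gt_eqF.
suff h m : approximable (m%:R * e) (commutator (g (m%:R / n%:R)) w).
  by have := h n; rewrite mulfV.
elim: m => [|m ih].
  rewrite !mul0r g0 commutator1 //; exists 1; split; first exact: PP1.
    exact: nm1_le1.
  by rewrite subrr nm0.
have [U1 U2] := (Ug (m%:R / n%:R), Ug (m.+1%:R / n%:R)).
set u := g (m%:R / n%:R) in ih U1 *; set v := g (m.+1%:R / n%:R) in U2 *.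
have Usu := unitary_star U1.
have -> : v = u * (star u * v) by rewrite mulrA U1.2 mul1r.
rewrite commutatorM // (_ : m.+1%:R * e = e + m%:R * e); last first.
  by rewrite -(natr1 m); ring.
apply: approximableM ih.
  have Uc : unitary A (commutator (star u * v) w).
    by apply: commutator_unitary => //; exact: unitaryM.
  by apply: unitaryM => //; exact: unitaryM.
apply: approximable_conj => //; apply: near; first exact: unitaryM.
rewrite -U1.1 -mulrBr nm_unitaryM //; apply: le_trans (lg _ _) _.
by rewrite -mulrBl -(natr1 m) addrAC subrr add0r ger0_norm ?mul1r.
Qed.

(** Cutting both paths into [n] steps leaves [n^2] commutators with error [O(1/n^3)] each, hence
    [C / n] altogether. *)
Lemma commutator_near1 u v : unitary A u -> unitary A v ->
  nm (u - 1) <= 2^-1 -> nm (v - 1) <= 2^-1 -> closure PP (commutator u v).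
Proof.
move=> Uu Uv u1 v1.
have [g [g0 g1 Ug lg]] := unitary_path Uu u1.
have [k [k0 k1 Uk lk]] := unitary_path Uv v1.
pose C : R := 40 * 4 ^+ 3.
(* From 16 on, [4 / n <= 1 / 4], as [commutator_near_product] requires. *)
have main n : (16 <= n)%N -> approximable (C / n%:R) (commutator u v).
  move=> n16; have n0 : (0 < n)%N by apply: leq_trans n16.
  have n0' : 0 < n%:R :> R by rewrite ltr0n.
  have n4 : 4 / n%:R <= 4^-1 :> R.
    rewrite ler_pdivrMr //; have : 16%:R <= n%:R :> R by rewrite ler_nat.
    lra.
  pose e := 2 * (20 * (4 / n%:R) ^+ 3) : R.
  have -> : C / n%:R = n%:R * (n%:R * e) :> R.
    by rewrite /e /C; field; rewrite gt_eqF.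
  (* Only the first argument can be subdivided; adjoints swap the arguments, so the path of [v] is
     cut first and that of [u] afterwards. *)
  rewrite -star_commutator; apply: approximable_star.
  rewrite -k1; apply: approximable_path => // y Uy y1.
  rewrite -star_commutator; apply: approximable_star.
  rewrite -g1; apply: approximable_path => // x Ux x1.
  have [z Pz xyz] := commutator_near_product Ux Uy n4 x1 y1.
  exact: approximable_normalize (commutator_unitary Ux Uy) Pz xyz.
apply/closureP => e e0.
have C0 : 0 <= C by rewrite /C mulr_ge0 // exprn_ge0.
have := archi_boundP (divr_ge0 C0 (ltW e0)); set m := Num.bound _ => Cm.
have [z [Pz _ xz]] := main (16 + m)%N (leq_addr _ _); exists z => //.
apply: le_lt_trans xz _; rewrite ltr_pdivrMr ?ltr0n //.
rewrite mulrC -ltr_pdivrMr //; apply: lt_le_trans Cm _.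
by rewrite ler_nat leq_addl.
Qed.

Lemma closure_PP_conj u x : unitary A u -> closure PP x ->
  closure PP (u * x * star u).
Proof.
move=> Uu /closureP cx; apply/closureP => e /cx[y Py xy].
exists (u * y * star u); first exact: PP_conj.
have -> : u * x * star u - u * y * star u = u * (x - y) * star u by ncring.
by rewrite nm_Munitary ?nm_unitaryM //; exact: unitary_star.
Qed.

(** The closure of [PP] is stable under products, adjoints and unitary conjugation, so the
    commutator identities give a subgroup to which [U0_sub_subgroup] applies. *)
Lemma commutator_subgroup (W : set A) : W `<=` unitary A ->
  unitary_subgroup [set u | unitary A u /\
    forall w, W w -> closure PP (commutator u w)].
Proof.
move=> WU; split.
- by move=> u [].
- split=> [|w /WU Uw]; first exact: unitary1.
  by rewrite commutator1 //; apply: subset_closure; exact: PP1.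
- move=> u v [Uu uW] [Uv vW]; split=> [|w Ww]; first exact: unitaryM.
  rewrite commutatorM //; last exact: WU.
  apply: (closureM PPM); last exact: uW.
  by apply: closure_PP_conj => //; exact: vW.
- move=> u [Uu uW]; split=> [|w Ww]; first exact: unitary_star.
  have := closure_PP_conj (unitary_star Uu) (closure_star PP_star (uW w Ww)).
  by rewrite starK commutator_starl.
Qed.

(** One argument at a time: with [w] near 1 fixed, the other argument extends from a neighbourhood
    of 1 to [U0]; then the roles are exchanged by taking adjoints. *)
Lemma commutator_U0 u v : U0 A u -> U0 A v -> closure PP (commutator u v).
Proof.
have e2 : 0 < 2^-1 :> R by rewrite invr_gt0.
pose W := [set w | unitary A w /\ nm (w - 1) <= 2^-1].
have WU : W `<=` unitary A by move=> w [].
have U0W w x : W w -> U0 A x -> closure PP (commutator x w).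
  move=> Ww Ux.
  have [|_] := U0_sub_subgroup (commutator_subgroup WU) e2 _ Ux.
    move=> y Uy y1; split=> // z [Uz z1].
    by apply: commutator_near1 => //; exact: ltW.
  exact.
move=> U0u U0v.
have [|_] := U0_sub_subgroup (commutator_subgroup (@U0_unitary R A)) e2 _ U0u.
  move=> y Uy y1; split=> // z U0z.
  rewrite -star_commutator; apply: (closure_star PP_star).
  by apply: U0W => //; split=> //; exact: ltW.
exact.
Qed.

Lemma closure_DU0_PP : closure (DU0 A) `<=` closure PP.
Proof.
suff h : DU0 A `<=` closure PP.
  move=> u cu; rewrite -(_ : closure (closure PP) = closure PP).
    exact: (closure_subset h).
  by symmetry; apply/closure_id; exact: closed_closure.
have comm u v : U0 A u -> U0 A v -> closure PP (u * v * star u * star v).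
  exact: commutator_U0.
suff h : DU0 A `<=` [set u | unitary A u /\ closure PP u] by move=> u /h[].
apply: smallest_sub.
  split.
  - by move=> u [].
  - split; first exact: unitary1.
    by apply: subset_closure; exact: PP1.
  - move=> u v [Uu Pu] [Uv Pv]; split; first exact: unitaryM.
    exact: (closureM PPM).
  - move=> u [Uu Pu]; split; first exact: unitary_star.
    exact: (closure_star PP_star).
move=> _ [u Uu [v Uv <-]]; split; last exact: comm.
by apply: commutator_unitary; exact: U0_unitary.
Qed.

Lemma DU0_positive_Ptilde u a : closure (DU0 A) u -> positive A a -> GL A a ->
  Ptilde A (u * a).
Proof.
move=> Du pa [b ab]; split.
  apply: (closureM PPM); first exact: closure_DU0_PP.
  by apply: subset_closure; exact: positive_PP.
have [DU _ _ _] := @DU0_subgroup R A.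
have Uu : unitary A u by apply: closure_unitary; exact: (closure_subset DU).
by exists (b * star u); apply: is_inverseM => //; exact: unitary_inverse.
Qed.

End Products.

(** * Polar decomposition of a perturbed product *)

Section Polar.
Variables (R : realType) (A : cstarAlgType R).
Implicit Types (a b c d g p q r u v w x y z : A) (s t e K : R).

(* With [U] a unitary of imaginary part [p / (4 K)], the commutator of [p] and [d]
   is, up to a factor, [x - U x U^*] for a skew-adjoint [x]; it is then matched by
   the group commutator of [1 + x + O(x^2)] and [U]. *)
Lemma DU0_near_skew p d K e : star p = p -> star d = d -> 1 <= K ->
  nm p <= K -> nm d <= e -> 2 * K * e <= 3^-1 ->
  exists2 v, DU0 A v &
    nm (v - 1 - rs A 2^-1 * (p * d - d * p)) <= 16 * K ^+ 2 * e ^+ 2.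
Proof.
move=> sp sd K1 pK de Ke.
have e0 : 0 <= e by apply: le_trans de.
(* Scales [p] to norm at most [1 / 4], which puts [U = sqrt (1 - y^2) + i y] within [5 / 16] of 1
   and so in [U0]. *)
pose s := (4 * K)^-1.
have s0 : 0 < s by rewrite invr_gt0; lra.
have sK : s * (4 * K) = 1 by rewrite mulVf // gt_eqF //; lra.
pose y := rs A s * p.
have sy : star y = y by rewrite /y stM sp star_rs rsC.
have ny : nm y <= 4^-1.
  by rewrite /y nm_rsM gtr0_norm //; have := nm_ge0 p; nra.
have syy : star (y * y) = y * y by rewrite stM sy.
have nyy : nm (y * y) <= 16^-1.
  by have := nmM y y; have := nm_ge0 y; nra.
have nyy1 : nm (y * y) < 1 by lra.
have [Y [sY nY YE Yc]] := sqrt_near1 syy nyy1.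
pose g := 1 - Y; pose J := 'i%C *: y; pose U := g + J.
have sg : star g = g by rewrite /g starB star1 sY.
have sJ : star J = - J.
  rewrite /J starZ sy -scaleNr; congr (_ *: _); apply/eqP.
  by rewrite eq_complex /= oppr0 !eqxx.
have yg : y * g = g * y.
  by rewrite /g mulrBr mulrBl Yc ?mulr1 ?mul1r // mulrA.
have Jg : J * g = g * J by rewrite /J scalAl scalAr yg.
have JJ : J * J = - (y * y).
  rewrite /J scalAl scalAr scalerA.
  have -> : 'i%C * 'i%C = -1 :> complex R by rewrite -expr2 sqr_i.
  by rewrite scaleN1r.
have UU : unitary A U.
  rewrite /unitary /= /U starD sg sJ; split.
    have -> : (g - J) * (g + J) = g * g - J * J + (g * J - J * g) by ncring.
    by rewrite Jg subrr addr0 JJ opprK YE subrK.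
  have -> : (g + J) * (g - J) = g * g - J * J - (g * J - J * g) by ncring.
  by rewrite Jg subrr subr0 JJ opprK YE subrK.
have U01 : U0 A U.
  apply: near1_U0 => //.
  have -> : U - 1 = J - Y by rewrite /U /g; ncring.
  have := nmB J Y; rewrite /J nmZi; lra.
(* Conjugation by [U] turns [d U + star U d] into [U d + d star U], so [x - U x star U = i K
   [d, U - star U]]. As [U - star U = 2 i s p], this is [2 K s [p, d] = [p, d] / 2]. *)
pose x := 'i%C *: (rs A K * (d * U + star U * d)).
have sx : star x = - x.
  rewrite /x starZ stM star_rs starD !stM starK sd rsC -scaleNr addrC.
  congr (_ *: _); apply/eqP.
  by rewrite eq_complex /= oppr0 !eqxx.
have nx : nm x <= 2 * K * e.
  rewrite /x nmZi nm_rsM ger0_norm; last lra.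
  have := nmD (d * U) (star U * d).
  rewrite (nm_Munitary _ UU) (nm_unitaryM _ (unitary_star UU)).
  have := nm_ge0 (d * U + star U * d); nra.
have nx3 := le_trans nx Ke.
have zE : x - U * x * star U = rs A 2^-1 * (p * d - d * p).
  have -> : x - U * x * star U =
    'i%C *: (rs A K * (d * (U - star U) - (U - star U) * d)).
    rewrite /x; set Z := rs A K * _; rewrite scalAr scalAl -scalerBr.
    congr (_ *: _); rewrite /Z rsCA -(mulrA (rs A K)) -mulrBr; congr (_ * _).
    have -> : U * (d * U + star U * d) * star U =
      U * d * (U * star U) + (U * star U) * d * star U by ncring.
    rewrite UU.2; ncring.
  have -> : U - star U = J + J by rewrite /U starD sg sJ; ncring.
  have -> : d * (J + J) - (J + J) * d = 'i%C *: (rs A (2 * s) * (d * p - p * d)).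
    have -> : d * (J + J) - (J + J) * d = 'i%C *: ((d * y - y * d) + (d * y - y * d)).
      rewrite /J mulrDl mulrDr !scalAl !scalAr !scalerDr !scalerN; ncring.
    have -> : 2 * s = s + s by ring.
    congr (_ *: _); rewrite /y rsCA rsD; ncring.
  rewrite scalAr scalerA.
  have -> : 'i%C * 'i%C = -1 :> complex R by rewrite -expr2 sqr_i.
  rewrite scaleN1r rsMA -mulrN opprB; congr (rs A _ * _).
  lra.
have nx2 : nm x <= 2^-1 by lra.
have [f Uf fx] := skew_unitary_approx sx nx2.
have nf : nm (f - 1) <= nm x + nm x ^+ 2.
  have -> : f - 1 = (f - 1 - x) + x by rewrite subrK.
  by apply: le_trans (nmD _ _) _; lra.
have x0 := nm_ge0 x.
have f0 : U0 A f by apply: near1_U0 => //; apply: le_trans nf _; nra.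
exists (f * U * star f * star U); first exact: DU0_commutator.
rewrite -zE; set E := f - 1 - x in fx.
(* With [f = 1 + x + E] the first-order terms cancel; each remaining summand is of second order in
   [x]. *)
have -> : f * U * star f * star U - 1 - (x - U * x * star U) =
    E + (1 - f) * (U * x * star U) + f * (U * star E * star U).
  have -> : star E = star f - 1 + x by rewrite /E !starB star1 sx opprK.
  have -> : f * (U * (star f - 1 + x) * star U) =
    f * U * star f * star U - f * (U * star U) + f * (U * x * star U) by ncring.
  rewrite UU.2 /E; ncring.
have Us := unitary_star UU.
apply: le_trans (nmD _ _) _.
rewrite (nm_unitaryM _ Uf) (nm_Munitary _ Us) (nm_unitaryM _ UU) nm_star.
have := nmD E ((1 - f) * (U * x * star U)).
have := nmM (1 - f) (U * x * star U).
rewrite (nm_Munitary _ Us) (nm_unitaryM _ UU) (nmBC 1 f).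
have h1 : nm x ^+ 2 <= (2 * K * e) ^+ 2 by rewrite lerXn2r // nnegrE; nra.
have : nm (f - 1) * nm x <= (nm x + nm x ^+ 2) * nm x by rewrite ler_wpM2r.
have -> : 16 * K ^+ 2 * e ^+ 2 = 4 * (2 * K * e) ^+ 2 by ring.
nra.
Qed.

(** [r] commutes with [b], so [r * b] is its inverse; it is self-adjoint with square [b], and the
    C*-identity gives the norm. *)
Lemma sqrt_inverse r q b : star r = r -> r * r = q -> is_inverse q b ->
  exists2 y, is_inverse r y & nm y ^+ 2 = nm b.
Proof.
move=> sr rr qb; have rb : r * b = b * r.
  by apply: is_inverse_comm qb _; rewrite -rr mulrA.
have iy : is_inverse r (r * b).
  by split; rewrite ?mulrA ?rr ?qb.1 // rb -mulrA rr qb.2.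
exists (r * b) => //; rewrite -nm_star_mul (is_inverse_sa iy sr).
by rewrite {1}rb -mulrA (mulrA r) rr qb.1 mulr1.
Qed.

(** The difference solves the Sylvester equation [p (p - r) + (p - r) r = p^2 - r^2 = 0], so
    [sylvester_bound] forces it to vanish. *)
Lemma sqrt_uniq p r (delta : R) : 0 < delta -> npos (p - rs A delta) -> npos r ->
  p * p = r * r -> r = p.
Proof.
move=> d0 ps pr e; have := sylvester_bound (p - r) d0 ps pr.
have -> : p * (p - r) + (p - r) * r = p * p - r * r by ncring.
rewrite e subrr nm0 pmulr_rle0 // => h.
apply/esym/eqP; rewrite -subr_eq0; apply/eqP/nm_eq0/le_anti.
by rewrite h nm_ge0.
Qed.

Lemma unitary_of_GL w : star w * w = 1 -> GL A w -> unitary A w.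
Proof.
move=> ww [y [wy yw]]; split=> //.
by rewrite (_ : star w = y) // -[star w]mulr1 -wy mulrA ww mul1r.
Qed.

Lemma sa_nm_le_npos a s : star a = a -> nm a <= s -> npos (a + rs A s).
Proof.
move=> sa h; have -> : a + rs A s = a + rs A (nm a) + rs A (s - nm a).
  by rewrite rsD rsN; ncring.
by apply: nposD; [exact: sa_nm_npos|apply: npos_rs; lra].
Qed.

(* Comparing [|c p|] with [p]: the difference [d] solves a perturbed Sylvester
   equation [p d + d p = 2 p (c - 1) p], so the unitary part of [c p] is
   [1 + (p^-1 d - d p^-1) / 2] to first order in [c - 1]. *)
Lemma polar_perturb_explicit p b c K e : npos p -> is_inverse p b -> star c = c ->
  1 <= K -> nm p <= K -> nm b <= K -> nm (c - 1) <= e -> 36 * K ^+ 4 * e <= 1 ->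
  exists r w v, [/\ npos r, unitary A w, DU0 A v, c * p = w * r &
    nm (w - v) <= 686 * K ^+ 8 * e ^+ 2].
Proof.
move=> pp pb sc K1 pK bK ce Ke; have sp := pp.1.
have sb : star b = b by exact: is_inverse_sa pb sp.
have e0 : 0 <= e by apply: le_trans ce.
have K0 : 0 < K by lra.
have K41 : 1 <= K ^+ 4 by exact: exprn_ege1.
have e1 : e <= 36^-1 by nra.
have KV : K^-1 * K = 1 by rewrite mulVf // gt_eqF.
have KV0 : 0 < K^-1 by rewrite invr_gt0.
pose q := p * c * c * p.
have qE : q = star (c * p) * (c * p) by rewrite stM sc sp /q !mulrA.
have sq : star q = q by rewrite qE stM starK.
have cE : q - p * p = p * ((c - 1) + (c - 1) + (c - 1) * (c - 1)) * p.
  by rewrite /q; ncring.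
have nq : nm (q - p * p) <= 3 * K ^+ 2 * e.
  rewrite cE; set g := c - 1 in ce *.
  have h1 : nm (g + g + g * g) <= 3 * e.
    have := nmD (g + g) (g * g); have := nmD g g; have := nmM g g.
    by have := nm_ge0 g; nra.
  have h2 := le_trans (nmM p _) (ler_pM (nm_ge0 _) (nm_ge0 _) pK h1).
  have := le_trans (nmM _ p) (ler_pM (nm_ge0 _) (nm_ge0 _) h2 pK).
  by have -> : K * (3 * e) * K = 3 * K ^+ 2 * e by ring.
(* From [nm (b * b) <= K^2] one gets [p^2 >= 2 t]; as [q] lies within [t] of [p^2], it satisfies
   [q >= t]. *)
pose t := (4 * K ^+ 2)^-1.
have K20 : 0 < K ^+ 2 by exact: exprn_gt0.
have tK : t * (4 * K ^+ 2) = 1 by rewrite /t mulVf // gt_eqF //; lra.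
have t0 : 0 < t by rewrite /t invr_gt0; lra.
have nqt : nm (q - p * p) <= t.
  apply: le_trans nq _; rewrite -(ler_pM2r (_ : 0 < 4 * K ^+ 2)); last lra.
  rewrite tK; apply: le_trans Ke.
  have -> : 3 * K ^+ 2 * e * (4 * K ^+ 2) = 12 * (K ^+ 4 * e) by ring.
  have : 0 <= K ^+ 4 * e by rewrite mulr_ge0 // exprn_ge0 // ltW.
  lra.
have bb : is_inverse (p * p) (b * b) by exact: is_inverseM.
have nbb : nm (b * b) <= K ^+ 2.
  by rewrite expr2; apply: le_trans (nmM _ _) _; exact: ler_pM.
have pq : npos (q - rs A t).
  have -> : q - rs A t = (p * p - rs A (2 * t)) + ((q - p * p) + rs A t).
    have -> : 2 * t = t + t by ring.
    rewrite rsD; ncring.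
  apply: nposD.
    apply: npos_shift bb _ _; [exact: npos_sqr|lra|].
    have := nm_ge0 (b * b); nra.
  by apply: sa_nm_le_npos => //; rewrite starB sq stM sp.
have [r [pr rr _]] := spos_sqrt t0 pq; have sr := pr.1.
have [qi iq nqi] := spos_inverse t0 pq.
have [ri ir nri] := sqrt_inverse sr rr iq.
have ri2 : nm ri <= 2 * K.
  have : nm ri ^+ 2 <= (2 * K) ^+ 2.
    have -> : (2 * K) ^+ 2 = t^-1 by rewrite /t invrK; ring.
    by rewrite nri.
  by have := nm_ge0 ri; nra.
pose d := r - p.
have sd : star d = d by rewrite /d starB sr sp.
have nd : nm d <= 6 * K ^+ 3 * e.
  have k2 : 0 < (2 * K)^-1 by rewrite invr_gt0; lra.
  have kk : (2 * K)^-1 * (2 * K) = 1 by rewrite mulVf // gt_eqF //; lra.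
  have ps : npos (p - rs A (2 * K)^-1).
    apply: npos_shift pb (ltW k2) _ => //; have := nm_ge0 b; nra.
  have := sylvester_bound d k2 ps pr.
  have -> : p * d + d * r = q - p * p by rewrite -rr /d; ncring.
  move=> h; have {h} := le_trans h nq.
  rewrite mulrC ler_pdivrMr; last lra.
  by have -> : 3 * K ^+ 2 * e * (2 * K) = 6 * K ^+ 3 * e by ring.
have [ci ic _] : exists2 ci, is_inverse c ci & True.
  have c1 : nm (1 - c) < 1 by rewrite nmBC; lra.
  have [y iy _] := neumann c1; exists y => //.
  by move: iy; rewrite opprB addrCA subrr addr0.
pose w := c * p * ri.
have iw : is_inverse w (r * (b * ci)).
  by apply: is_inverseM (is_inverse_sym ir); exact: is_inverseM.
have ww : star w * w = 1.
  rewrite /w stM (is_inverse_sa ir sr).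
  have -> : ri * star (c * p) * (c * p * ri) = ri * (star (c * p) * (c * p)) * ri.
    by rewrite !mulrA.
  by rewrite -qE -rr mulrA ir.2 mul1r ir.1.
have Uw : unitary A w by apply: unitary_of_GL => //; eexists; exact: iw.
pose z := rs A 2^-1 * (b * d - d * b).
have h2 : `|2^-1| = 2^-1 :> R by rewrite ger0_norm // invr_ge0.
have K4e : 2 * K * (6 * K ^+ 3 * e) <= 3^-1.
  have -> : 2 * K * (6 * K ^+ 3 * e) = 12 * (K ^+ 4 * e) by ring.
  lra.
have [v Dv nv] := DU0_near_skew sb sd K1 bK nd K4e.
exists r, w, v; split=> //.
  by rewrite /w -mulrA ir.2 mulr1.
(* Multiplying by [r] clears the inverse in [w]. The first-order terms cancel through
   [b (p d + d p + d^2) = b (q - p^2)], leaving only quadratic ones. *)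
have key : (w - 1 - z) * r =
    rs A 2^-1 * (b * (d * d) - (c - 1) * (c - 1) * p) - z * d.
  have wr : w * r = c * p by rewrite /w -mulrA ir.2 mulr1.
  have -> : (w - 1 - z) * r = w * r - r - z * p - z * d by rewrite /d; ncring.
  rewrite wr; congr (_ - _).
  have half : rs A 2^-1 * (1 + 1) = 1.
    by rewrite mulrDr mulr1 -rsD -[RHS]rs1; congr (rs A _); field.
  have -> : c * p - r = rs A 2^-1 * (1 + 1) * (c * p - r) by rewrite half mul1r.
  rewrite -mulrA /z -(mulrA (rs A _)) -mulrBr; congr (rs A _ * _).
  have bp x : b * (p * x) = x by rewrite mulrA pb.2 mul1r.
  have : b * (p * d + d * p + d * d) = b * (q - p * p).
    by rewrite -rr /d; congr (b * _); ncring.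
  rewrite cE -!mulrA bp => E.
  have -> : (b * d - d * b) * p = b * (p * d + d * p + d * d) - b * (p * d) -
      b * (d * d) - d * (b * p) by ncring.
  rewrite E bp pb.2 mulr1 /d; ncring.
have nz : nm z <= K * (6 * K ^+ 3 * e).
  rewrite /z nm_rsM h2; have := nmB (b * d) (d * b).
  have := le_trans (nmM b d) (ler_pM (nm_ge0 _) (nm_ge0 _) bK nd).
  have := le_trans (nmM d b) (ler_pM (nm_ge0 _) (nm_ge0 _) nd bK); lra.
have nk : nm ((w - 1 - z) * r) <= 55 * K ^+ 7 * e ^+ 2.
  rewrite key; apply: le_trans (nmB _ _) _; rewrite nm_rsM h2.
  have := nmB (b * (d * d)) ((c - 1) * (c - 1) * p).
  have n1 := le_trans (nmM d d) (ler_pM (nm_ge0 _) (nm_ge0 _) nd nd).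
  have n2 := le_trans (nmM b _) (ler_pM (nm_ge0 _) (nm_ge0 _) bK n1).
  have n3 := le_trans (nmM (c - 1) _) (ler_pM (nm_ge0 _) (nm_ge0 _) ce ce).
  have n4 := le_trans (nmM _ p) (ler_pM (nm_ge0 _) (nm_ge0 _) n3 pK).
  have n5 := le_trans (nmM z d) (ler_pM (nm_ge0 _) (nm_ge0 _) nz nd).
  have n6 : e * e * K <= K ^+ 7 * e ^+ 2.
    have -> : e * e * K = K * e ^+ 2 by ring.
    by rewrite ler_wpM2r ?sqr_ge0 // exprS ler_peMr ?exprn_ege1 // ltW.
  move: n2 n5.
  have -> : K * (6 * K ^+ 3 * e * (6 * K ^+ 3 * e)) = 36 * (K ^+ 7 * e ^+ 2) by ring.
  have -> : K * (6 * K ^+ 3 * e) * (6 * K ^+ 3 * e) = 36 * (K ^+ 7 * e ^+ 2) by ring.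
  have : 0 <= K ^+ 7 * e ^+ 2 by rewrite mulr_ge0 // exprn_ge0 // ltW.
  lra.
have nw : nm (w - 1 - z) <= 110 * K ^+ 8 * e ^+ 2.
  have -> : w - 1 - z = (w - 1 - z) * r * ri by rewrite -mulrA ir.1 mulr1.
  apply: le_trans (nmM _ _) _.
  apply: le_trans (ler_pM (nm_ge0 _) (nm_ge0 _) nk ri2) _.
  by have -> : 55 * K ^+ 7 * e ^+ 2 * (2 * K) = 110 * K ^+ 8 * e ^+ 2 by ring.
(* The constant is [686 = 110 + 576], with [576 = 16 * 6^2] coming from [DU0_near_skew] applied to
   the bound [6 K^3 e] on [d]. *)
have -> : w - v = (w - 1 - z) - (v - 1 - z) by ncring.
apply: le_trans (nmB _ _) _; move: nv; rewrite -/z.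
have -> : 16 * K ^+ 2 * (6 * K ^+ 3 * e) ^+ 2 = 576 * (K ^+ 8 * e ^+ 2) by ring.
move: nw; lra.
Qed.

(** One constant depending on [K] alone, so that it can be fixed before the number of steps is
    chosen. *)
Lemma polar_perturb K : 1 <= K -> exists2 C, 0 < C &
  forall p b c e, npos p -> is_inverse p b -> star c = c ->
  nm p <= K -> nm b <= K -> nm (c - 1) <= e -> C * e <= 1 ->
  exists r w v, [/\ npos r, unitary A w, DU0 A v, c * p = w * r &
    nm (w - v) <= C * e ^+ 2].
Proof.
move=> K1; have K48 : K ^+ 4 <= K ^+ 8 by rewrite ler_weXn2l.
have K4 : 0 < K ^+ 4 by apply: exprn_gt0; lra.
exists (686 * K ^+ 8); first lra.
move=> p b c e pp ib sc pK bK ce Ke.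
apply: (@polar_perturb_explicit p b c K e) => //; apply: le_trans Ke.
by apply: ler_wpM2r; [exact: le_trans ce|lra].
Qed.

End Polar.

(** * Unitary parts of products *)

Section PolarClosed.
Variables (R : realType) (A : cstarAlgType R).
Implicit Types (a b c d g p q r u v w x y z : A) (s t e K : R).

(** Positive and invertible, in the quantitative form [a >= s > 0]. *)
Definition spos a := exists2 s, 0 < s & npos (a - rs A s).

Lemma spos_npos a : spos a -> npos a.
Proof. by move=> [s s0 h]; exact: npos_unshift h (ltW s0). Qed.

Lemma spos_GL a : spos a -> exists b, is_inverse a b.
Proof. by move=> [s s0 /(spos_inverse s0)[b ab _]]; exists b. Qed.

Lemma npos_GL_spos a b : npos a -> is_inverse a b -> spos a.
Proof.
move=> pa ab; have nb := nm_ge0 b; exists (nm b + 1)^-1.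
  by rewrite invr_gt0; lra.
apply: npos_shift ab _ _ => //; first by rewrite invr_ge0; lra.
by rewrite mulrC ltr_pdivrMr ?mul1r; lra.
Qed.

Lemma npos_scale s a : 0 <= s -> npos a -> npos (rs A s * a).
Proof.
move=> s0 [sa [M aM]]; split; first by rewrite stM sa star_rs rsC.
by exists (s * M); rewrite rsM -mulrBr nm_rsM ger0_norm // ler_wpM2l.
Qed.

(** The elements [u a] of the theorem, with [spos] in place of positive and invertible. *)
Definition polar_set : set A :=
  [set x | exists u p, [/\ closure (DU0 A) u, spos p & x = u * p]].

Lemma closure_DU0_unitary u : closure (DU0 A) u -> unitary A u.
Proof.
have [DU _ _ _] := @DU0_subgroup R A.
by move=> cu; apply: closure_unitary; exact: (closure_subset DU).
Qed.

Lemma closure_closure (T : set A) : closure (closure T) `<=` closure T.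
Proof.
move=> x /closureP cx; apply/closureP => e e0.
have e2 : 0 < e / 2 by lra.
have [y /closureP /(_ _ e2)[z Tz yz] xy] := cx _ e2.
by exists z => //; apply: le_lt_trans (nm_dist y _ _) _; lra.
Qed.

(* [a y = c_n ... c_1 y] with factors [c_j] within O(1/n) of 1; by
   [polar_perturb] each step moves the unitary part away from DU_0 by O(1/n^2). *)
Lemma polar_setM a y : spos a -> polar_set y -> polar_set (a * y).
Proof.
move=> [s s0 pas] [u0 [p0 [Du0 [s' s'0 pp0] yE]]].
have Uu0 := closure_DU0_unitary Du0.
have sa : star a = a by exact: (npos_unshift pas (ltW s0)).1.
have [p0i ip0 _] := spos_inverse s'0 pp0.
have iy : is_inverse y (p0i * star u0).
  by rewrite yE; apply: is_inverseM => //; exact: unitary_inverse.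
set yi := p0i * star u0 in iy.
(* A common lower bound of 1 and [a], hence of every [al t] on the segment between them; it bounds
   all the inverses by [m^-1]. *)
pose m := Num.min 1 s.
have m0 : 0 < m by rewrite lt_min ltr01.
have m1 : m <= 1 by rewrite ge_min lexx.
have ms : m <= s by rewrite ge_min lexx orbT.
have pam : npos (a - rs A m) := npos_shift_le pas ms.
pose al t := 1 + rs A t * (a - 1).
have sal t : star (al t) = al t.
  by rewrite /al starD star1 stM starB sa star1 star_rs rsC.
have inv t : 0 <= t <= 1 -> exists2 b, is_inverse (al t) b & nm b <= m^-1.
  move=> /andP[t0 t1]; apply: spos_inverse => //.
  have -> : al t - rs A m = rs A ((1 - t) * (1 - m)) + rs A t * (a - rs A m).
    by rewrite rsM !rsD !rsN rs1 /al; ncring.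
  apply: nposD; first by apply: npos_rs; nra.
  exact: npos_scale.
pose M := 1 + nm (a - 1).
have M0 : 1 <= M by rewrite /M; have := nm_ge0 (a - 1); lra.
have nal t : 0 <= t <= 1 -> nm (al t) <= M.
  move=> /andP[t0 t1]; apply: le_trans (nmD _ _) _.
  rewrite nm_rsM ger0_norm //; have := nm1_le1 A; have := nm_ge0 (a - 1).
  rewrite /M; nra.
have mi0 : 0 < m^-1 by rewrite invr_gt0.
(* Bounds, along the whole segment, the positive part [star u * (al t * y)] and its inverse
   [yi * b * u]. *)
pose K := 1 + M * nm y + nm yi * m^-1.
have ny := nm_ge0 y; have nyi := nm_ge0 yi.
have K1 : 1 <= K.
  have : 0 <= M * nm y by rewrite mulr_ge0 //; lra.
  have : 0 <= nm yi * m^-1 by rewrite mulr_ge0 // ltW.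
  rewrite /K; lra.
have KM : M * nm y <= K.
  have : 0 <= nm yi * m^-1 by rewrite mulr_ge0 // ltW.
  rewrite /K; lra.
have Km : nm yi * m^-1 <= K.
  have : 0 <= M * nm y by rewrite mulr_ge0 //; lra.
  rewrite /K; lra.
pose B := M * m^-1.
have B0 : 0 <= B by rewrite mulr_ge0 ?ltW //; lra.
have [D D0 perturb] := @polar_perturb R A K K1.
pose C := D * B ^+ 2.
have C0 : 0 <= C by rewrite mulr_ge0 ?sqr_ge0 // ltW.
have main n : (0 < n)%N -> D * B <= n%:R ->
    exists u p v, [/\ unitary A u, npos p, closure (DU0 A) v, a * y = u * p &
      nm (u - v) <= C / n%:R].
  move=> n0 nK.
  have n0' : 0 < n%:R :> R by rewrite ltr0n.
  have nn0 : n%:R != 0 :> R by rewrite gt_eqF.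
  pose e := B / n%:R.
  have Ke : D * e <= 1 by rewrite /e mulrA ler_pdivrMr // mul1r.
  suff h j : (j <= n)%N -> exists u p v, [/\ unitary A u, npos p,
      closure (DU0 A) v, al (j%:R / n%:R) * y = u * p &
      nm (u - v) <= j%:R * (C / n%:R ^+ 2)].
    have [u [p [v [Uu pp Dv ay uv]]]] := h n (leqnn n).
    exists u, p, v; split=> //.
      by rewrite -ay mulfV // /al rs1 mul1r addrCA subrr addr0.
    by apply: le_trans uv _; rewrite le_eqVlt; apply/orP; left; apply/eqP; field.
  elim: j => [_|j ih jn].
    exists u0, p0, u0; split=> //.
    - exact: npos_unshift pp0 (ltW s'0).
    - by rewrite mul0r /al rs0 mul0r addr0 mul1r.
    - by rewrite subrr nm0 mul0r.
  have [u [p [v [Uu pp Dv ay uv]]]] := ih (ltnW jn).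
  have [us1 us2] := Uu; have Us := unitary_star Uu.
  set t := j%:R / n%:R in ay.
  have t01 : 0 <= t <= 1.
    rewrite /t divr_ge0 ?ler0n //= ler_pdivrMr // mul1r ler_nat; exact: ltnW.
  have [b ib nb] := inv t t01.
  (* Chosen so that [1 + g] carries [al (j / n)] to [al ((j + 1) / n)]. *)
  pose g := rs A n%:R^-1 * ((a - 1) * b).
  have ab : (a - 1) * b = b * (a - 1).
    apply: is_inverse_comm ib _; rewrite /al; move: (a - 1) => x.
    by rewrite mulrDr rsCA mulrDl mul1r mulr1 mulrA.
  have sb := is_inverse_sa ib (sal t).
  have sg : star g = g.
    by rewrite /g stM stM star_rs sb starB sa star1 rsC ab.
  have ng : nm g <= e.
    rewrite /g nm_rsM ger0_norm ?invr_ge0 ?ler0n // mulrC ler_pdivrMr // mulfVK //.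
    apply: le_trans (nmM _ _) _; apply: ler_pM => //.
    by rewrite /M; lra.
  have alS : al (j.+1%:R / n%:R) = (1 + g) * al t.
    have -> : (1 + g) * al t = al t + rs A n%:R^-1 * ((a - 1) * (b * al t)).
      by rewrite /g; ncring.
    rewrite ib.2 mulr1 -(natr1 j) mulrDl mul1r /al rsD; ncring.
  (* Moves the new factor past the unitary: [(1 + g) u p = u (c p)], so only [c p] needs a new polar
     decomposition. *)
  pose c := 1 + star u * g * u.
  have sc : star c = c by rewrite /c starD star1 stM (stM (star u)) starK sg mulrA.
  have nc : nm (c - 1) <= e.
    by rewrite /c addrAC subrr add0r (nm_Munitary _ Uu) (nm_unitaryM _ Us).
  have pE : p = star u * (al t * y) by rewrite ay mulrA us1 mul1r.
  have ip : is_inverse p (yi * b * u).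
    rewrite pE; apply: is_inverseM; last exact: is_inverseM.
    exact: is_inverse_sym (unitary_inverse Uu).
  have np : nm p <= K.
    rewrite pE (nm_unitaryM _ Us); apply: le_trans (nmM _ _) _.
    by apply: le_trans KM; apply: ler_wpM2r => //; exact: nal.
  have npi : nm (yi * b * u) <= K.
    rewrite (nm_Munitary _ Uu); apply: le_trans (nmM _ _) _.
    by apply: le_trans Km; exact: ler_wpM2l.
  have [r [w [vw [pr Uw Dvw cp wv]]]] :=
    perturb _ _ _ _ pp ip sc np npi nc Ke.
  exists (u * w), r, (v * vw); split=> //.
  - exact: unitaryM.
  - have [_ _ DM _] := @DU0_subgroup R A.
    by apply: (closureM DM) => //; exact: subset_closure.
  - rewrite alS -mulrA ay -mulrA -cp /c.
    have -> : u * ((1 + star u * g * u) * p) = u * p + (u * star u) * (g * (u * p)).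
      by ncring.
    rewrite us2; ncring.
  have -> : u * w - v * vw = u * (w - vw) + (u - v) * vw by ncring.
  apply: le_trans (nmD _ _) _; rewrite (nm_unitaryM _ Uu).
  rewrite nm_Munitary; last first.
    by apply: closure_DU0_unitary; exact: subset_closure.
  have -> : j.+1%:R * (C / n%:R ^+ 2) = C / n%:R ^+ 2 + j%:R * (C / n%:R ^+ 2).
    by rewrite -(natr1 j); ring.
  apply: lerD uv; apply: le_trans wv _; rewrite /e /C.
  by rewrite le_eqVlt; apply/orP; left; apply/eqP; field.
have large e : 0 < e -> exists n, [/\ (0 < n)%N, D * B <= n%:R &
    C / n%:R < e].
  move=> e0; have k0 : 0 <= D * B.
    by rewrite mulr_ge0 // ltW.
  have h1 := archi_boundP k0; have h2 := archi_boundP (divr_ge0 C0 (ltW e0)).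
  set i := Num.bound _ in h1; set j := Num.bound _ in h2.
  exists (i + j).+1; split=> //.
    by apply: le_trans (ltW h1) _; rewrite ler_nat -addnS leq_addr.
  rewrite ltr_pdivrMr ?ltr0n // mulrC -ltr_pdivrMr //.
  by apply: lt_le_trans h2 _; rewrite ler_nat -addSn leq_addl.
have [n [n0 nK _]] := large 1 ltr01.
have [u [p [v [Uu pp _ ay _]]]] := main n n0 nK.
have [ai ia] : exists ai, is_inverse a ai.
  by apply: spos_GL; exists s.
have ip : is_inverse p ((yi * ai) * u).
  have -> : p = star u * (a * y) by rewrite ay mulrA Uu.1 mul1r.
  apply: is_inverseM; last exact: is_inverseM.
  exact: is_inverse_sym (unitary_inverse Uu).
have sp : spos p by exact: npos_GL_spos ip.
exists u, p; split=> //; apply: closure_closure; apply/closureP => e e0.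
have [n' [n'0 n'K Ce]] := large e e0.
have [u' [p' [v' [Uu' pp' Dv' ay' uv']]]] := main n' n'0 n'K.
(* Each [n] yields a decomposition of [a * y], and uniqueness of the positive square root identifies
   them all. The fixed [u] is therefore within [C / n'] of the closure for arbitrarily large
   [n']. *)
exists v' => //; suff -> : u = u' by apply: le_lt_trans Ce.
have pE : p' = p.
  have [s1 s10 ps1] := sp; apply: (sqrt_uniq s10 ps1 pp').
  have h x z : unitary A x -> npos z -> star (x * z) * (x * z) = z * z.
    move=> [x1 _] [sz _]; rewrite stM sz -mulrA (mulrA (star x)) x1 mul1r //.
  by have := h u p Uu pp; have := h u' p' Uu' pp'; rewrite -ay -ay' => <- <-.
have e1 : u = a * y * (yi * ai * u) by rewrite ay -mulrA ip.1 mulr1.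
have e2 : u' = a * y * (yi * ai * u) by rewrite ay' pE -mulrA ip.1 mulr1.
exact: etrans e1 (esym e2).
Qed.

Lemma polar_set1 : polar_set 1.
Proof.
have [_ D1 _ _] := @DU0_subgroup R A.
exists 1, 1; split; [exact: subset_closure| |by rewrite mulr1].
by exists 1 => //; rewrite rs1 subrr -(rs0 A); exact: npos_rs.
Qed.

(** A positive factor [a] is a limit of the strictly positive [a + e / 2], to which [polar_setM]
    applies. *)
Lemma positive_products_polar : positive_products A `<=` closure polar_set.
Proof.
apply: PP_ind => [|a x pa _ cx]; first exact: subset_closure polar_set1.
apply: (closureM polar_setM) cx; apply/closureP => e e0.
exists (a + rs A (e / 2)).
  by exists (e / 2); [lra|rewrite addrK].
rewrite opprD addrA subrr add0r nmN; have := nm_rs A (e / 2).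
by rewrite ger0_norm; lra.
Qed.

(** If [u p] approximates [x], then [p^2] approximates [q = star x * x], and [sylvester_bound] makes
    [p] close to the root [r] of [q]. Hence [u] is close to [x r^-1]. *)
Lemma closure_polar_GL x : closure polar_set x -> GL A x -> polar_set x.
Proof.
move=> /closureP cx [xi ix]; pose q := star x * x.
have sq : star q = q by rewrite /q stM starK.
have dif y : nm (q - star y * y) <= (nm x + nm y) * nm (x - y).
  have -> : q - star y * y = star x * (x - y) + star (x - y) * y.
    by rewrite /q starB; ncring.
  apply: le_trans (nmD _ _) _.
  have := nmM (star x) (x - y); have := nmM (star (x - y)) y.
  by rewrite !nm_star; lra.
pose K := 2 * nm x + 1; have nx := nm_ge0 x.
have K0 : 0 < K by rewrite /K; lra.
have approx e : 0 < e -> exists u p, [/\ closure (DU0 A) u, npos p,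
    nm (x - u * p) <= e & nm (q - p * p) <= e].
  (* With [d <= 1] the approximant [u p] satisfies [nm x + nm (u * p) <= K]; then [d * K <= e]
     controls [q - p^2]. *)
  move=> e0; pose d := Num.min 1 (Num.min e (e / K)).
  have d0 : 0 < d by rewrite !lt_min ltr01 e0 divr_gt0.
  have d1 : d <= 1 by rewrite ge_min lexx.
  have de : d <= e by rewrite !ge_min lexx orbT.
  have dK : d * K <= e by rewrite -ler_pdivlMr // !ge_min lexx !orbT.
  have [_ [u [p [Du /spos_npos pp ->]]] xy] := cx _ d0.
  have [u1 _] := closure_DU0_unitary Du.
  exists u, p; split=> //; first lra.
  have <- : star (u * p) * (u * p) = p * p.
    by rewrite stM pp.1 -mulrA (mulrA (star u)) u1 mul1r.
  apply: le_trans (dif _) _.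
  have := nm_dist x (u * p) 0; rewrite !subr0 (nmBC _ x) => ny.
  have : nm x + nm (u * p) <= K by rewrite /K; lra.
  by have := nm_ge0 (x - u * p); have := nm_ge0 (u * p); nra.
have pq : npos q.
  apply: npos_closed; apply/closureP => e e0.
  have e2 : 0 < e / 2 by lra.
  have [u [p [_ pp _ qp]]] := approx _ e2; exists (p * p); last lra.
  by apply: npos_sqr; exact: pp.1.
have iq : is_inverse q (xi * star xi).
  exact: is_inverseM (is_inverse_star ix) ix.
have [s s0 ps] := npos_GL_spos pq iq.
have [r [pr rr _]] := spos_sqrt s0 ps.
have [ri ir _] := sqrt_inverse pr.1 rr iq.
have spr := npos_GL_spos pr ir.
have [s1 s10 ps1] := spr.
exists (x * ri), r; split=> //; last by rewrite -mulrA ir.2 mulr1.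
apply: closure_closure; apply/closureP => e e0.
pose L := (1 + s1^-1) * (nm ri + 1).
have si0 : 0 < s1^-1 by rewrite invr_gt0.
have nri := nm_ge0 ri.
have L0 : 0 < L by apply: mulr_gt0; lra.
have e1 : 0 < e / L by rewrite divr_gt0.
have [u [p [Du pp xup qp]]] := approx _ e1; exists u => //.
have Uu := closure_DU0_unitary Du.
have -> : x * ri - u = (x - u * p - u * (r - p)) * ri.
  have -> : x - u * p - u * (r - p) = x - u * r by ncring.
  by rewrite mulrBl -(mulrA u) ir.1 mulr1.
have nd : nm (r - p) <= s1^-1 * (e / L).
  rewrite mulrC ler_pdivlMr // mulrC.
  apply: le_trans (sylvester_bound (r - p) s10 ps1 pp) _.
  by have -> : r * (r - p) + (r - p) * p = q - p * p by rewrite -rr; ncring.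
apply: le_lt_trans (nmM _ _) _.
have n1 : nm (x - u * p - u * (r - p)) <= (1 + s1^-1) * (e / L).
  apply: le_trans (nmB _ _) _; rewrite (nm_unitaryM _ Uu).
  by rewrite mulrDl mul1r lerD.
have n2 : (1 + s1^-1) * (e / L) * (nm ri + 1) = e.
  by rewrite /L; field; rewrite !gt_eqF //; lra.
have n3 : 0 < (1 + s1^-1) * (e / L) by rewrite mulr_gt0 //; lra.
have := ler_wpM2r nri n1; lra.
Qed.

Lemma Ptilde_polar x : Ptilde A x -> polar_set x.
Proof.
move=> [cx Gx]; apply: closure_polar_GL => //; apply: closure_closure.
exact: (closure_subset positive_products_polar).
Qed.

(** [csqrt] selects some positive root of [p^2]; [sqrt_uniq] shows that it is [p]. *)
Lemma polar_unitary_part u p : unitary A u -> spos p ->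
  unitary_part (u * p) = u.
Proof.
move=> [u1 _] sp; have pp := spos_npos sp; have [pi ip] := spos_GL sp.
have [s s0 ps] := sp.
rewrite /unitary_part (_ : cabs (u * p) = p) ?(cinvE ip) -?mulrA ?ip.1 ?mulr1 //.
have e : star (u * p) * (u * p) = p * p.
  by rewrite stM pp.1 -mulrA (mulrA (star u)) u1 mul1r.
rewrite /cabs e; apply: xget_unique.
  by split=> //; exact: npos_positive.
move=> h [/positive_npos ph hh]; exact: sqrt_uniq s0 ps ph _.
Qed.

Lemma unitary_part_polar x : GL A x -> unitary A (unitary_part x) ->
  exists a, [/\ positive A a, GL A a & x = unitary_part x * a].
Proof.
move=> [xi ix] Uw.
have iq : is_inverse (star x * x) (xi * star xi).
  exact: is_inverseM (is_inverse_star ix) ix.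
pose P := [set h : A | positive A h /\ h * h = star x * x].
have [h Ph] : exists h, P h.
  (* Without a root, [cabs x] takes the default value 0. Then either 0 is invertible or
     [unitary_part x] is both 0 and unitary; in both cases the algebra is zero, where 0 itself is a
     root. *)
  have [//|/set0P/negP] := pselect (exists h, P h).
  rewrite negbK => /eqP P0; exists 0.
  suff A0 y : y = 0 :> A.
    split; last by rewrite [LHS]A0 [RHS]A0.
    by apply: npos_positive; rewrite -(rs0 A); exact: npos_rs.
  have r0 : cabs x = 0.
    by apply: xgetPN => h Ph; have : P h by []; rewrite P0.
  have [[z [z0 _]]|n0] := pselect (GL A 0).
    by rewrite -[y]mulr1 -z0 mul0r mulr0.
  have c0 : cinv (0 : A) = 0 by apply: xgetPN => z iz; apply: n0; exists z.
  by rewrite -[y]mulr1 -Uw.1 /unitary_part r0 c0 !mulr0.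
have : P (cabs x) by apply: xgetPex; exists h.
set r := cabs x => - [pr rr]; have npr := positive_npos pr.
have [ri ir _] := sqrt_inverse npr.1 rr iq.
exists r; split=> //; first by exists ri.
by rewrite /unitary_part -/r (cinvE ir) -mulrA ir.2 mulr1.
Qed.

End PolarClosed.

Theorem theorem2 (R : realType) (A : cstarAlgType R) :
  Ptilde A = [set x : A | GL A x /\ closure (DU0 A) (unitary_part x)] /\
  Ptilde A = [set x : A | exists u a : A,
    [/\ closure (DU0 A) u, positive A a, GL A a & x = u * a]].
Proof.
have sub21 : [set x : A | exists u a : A, [/\ closure (DU0 A) u, positive A a,
    GL A a & x = u * a]] `<=` Ptilde A.
  by move=> _ [u [a [Du pa Ga ->]]]; exact: DU0_positive_Ptilde.
have sub13 : Ptilde A `<=` [set x | GL A x /\ closure (DU0 A) (unitary_part x)].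
  move=> x Px; have [_ Gx] := Px; split=> //.
  have [u [p [Du sp ->]]] := Ptilde_polar Px.
  by rewrite polar_unitary_part //; exact: closure_DU0_unitary.
have sub32 : [set x | GL A x /\ closure (DU0 A) (unitary_part x)] `<=`
    [set x : A | exists u a : A, [/\ closure (DU0 A) u, positive A a,
    GL A a & x = u * a]].
  move=> x [Gx Dx]; have Ux := closure_DU0_unitary Dx.
  have [a [pa Ga xE]] := unitary_part_polar Gx Ux.
  by exists (unitary_part x), a.
split; apply/seteqP; split=> //.
- exact: subset_trans sub32 sub21.
- exact: subset_trans sub13 sub32.
Qed.
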